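(* Let $X$ be a Polish space, $\rho$ a diffuse locally finite measure on $X$, $(Y_t)_{0\le t<1}$ the spatial Chinese restaurant-like process with parameter $\rho$, and $B\subset X$ a bounded Borel set. Put $U_{B,t}=U_B(Y_t)$. Then $(U_{B,t})_{0\le t<1}$ is a Markov process with state space the (finite) point measures on $\mathbb N$, and for $0\le s<t<1$ and $f$ bounded measurable its transition kernel is $$p^B_{s,t}(\eta,f)=\iint f(\eta_i+\eta_b)\,\bigl(U_B\mathsf S_{\frac{t-s}{1-s},\rho}\bigr)(\mathrm d\eta_i)\,\bigl(U_B(\mathsf S_{\frac{t-s}{1-s},\nu}\ast\Delta_\nu)\bigr)(\mathrm d\eta_b)$$ for almost every (with respect to the law of $Y_s$) $\nu\in\{\mu\in\mathcal M^{\cdot\cdot}(X):U_B(\mu)=\eta\}$.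
   Context: $\mathbb N=\{1,2,\dots\}$. $X$ is a Polish space with Borel $\sigma$-field $\mathcal B$ and ring $\mathcal B_0$ of bounded Borel sets; $\mathcal M(X)$ is the space of locally finite measures (finite on bounded sets) with the vague topology, $\mathcal M^{\cdot\cdot}(X)$ its closed subset of point measures. Pólya sum process: for $z\in[0,1)$ and $\kappa\in\mathcal M(X)$, $\mathsf S_{z,\kappa}$ denotes the unique law on $\mathcal M^{\cdot\cdot}(X)$ satisfying, for all measurable $h\ge 0$, $\iint h(x,\mu)\,\mu(\mathrm dx)\,\mathsf S_{z,\kappa}(\mathrm d\mu)=\iint h(x,\mu+\delta_x)\,z(\kappa+\mu)(\mathrm dx)\,\mathsf S_{z,\kappa}(\mathrm d\mu)$. Spatial Chinese restaurant-like process with parameter $\rho\in\mathcal M(X)$: the Markov process $(Y_t)_{0\le t<1}$ with values in $\mathcal M^{\cdot\cdot}(X)$ and càdlàg, increasing paths ($Y_s\le Y_t$ for $s\le t$) such that $Y_0=0$ and, for $0\le s<t<1$, the conditional law of $Y_t-Y_s$ given $Y_s$ is $\mathsf S_{\frac{t-s}{1-s},\,\rho+Y_s}$. For $\mu\in\mathcal M^{\cdot\cdot}(X)$, $U_B(\mu)$ is the finite point measure on $\mathbb N$ whose weight at $j$ is the number of $x\in B$ with $\mu(\{x\})=j$. $\Delta_\nu$ is the law of the point process which equals $\nu$ almost surely, $\ast$ is convolution of laws of random measures (law of the sum of independent copies), and for a law $\mathsf P$ on $\mathcal M^{\cdot\cdot}(X)$, $U_B\mathsf P$ is the image of $\mathsf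 P$ under $U_B$. *)

(* Defs.v *)
From HB Require Import structures.
From mathcomp Require Import all_boot all_order all_algebra.
From mathcomp Require Import all_classical all_reals all_analysis.
From mathcomp Require Import finmap measurable_realfun.

Set Implicit Arguments.
Unset Strict Implicit.
Unset Printing Implicit Defensive.

Import Order.TTheory GRing.Theory Num.Theory.
Import numFieldNormedType.Exports.

Local Open Scope classical_set_scope.
Local Open Scope ring_scope.

(* "Bounded" refers to a metric, so a Polish space comes with a complete metric
   inducing its topology.  [Complete] and [measurableType] force a Polish space
   to be nonempty. *)
HB.mixin Record isSeparable T & Topological T := {
  separable : exists2 D : set T, countable D & dense D
}.

#[short(type="polishType")]
HB.structure Definition Polish (R : numDomainType) :=
  { X of Metric R X & Complete X & isSeparable X }.

Definition borel (R : numDomainType) (X : polishType R) :=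
  g_sigma_algebraType (@open X).

HB.instance Definition _ (R : numDomainType) (X : polishType R) :=
  Measurable.on (borel X).

Section bounded.
Context {R : numDomainType} {X : polishType R}.

Definition bounded_subset (B : set X) := exists x r, B `<=` ball x r.

Record boundedBorel := BoundedBorel {
  bb_set :> set (borel X) ;
  bb_measurable : measurable bb_set ;
  bb_bounded : bounded_subset bb_set }.

End bounded.
Arguments boundedBorel {R} X.

Section locally_finite_measures.
Local Open Scope ereal_scope.
Context {R : realType}.

(* Measures of the library are functions on all sets, with no constraint on the
   non-measurable ones; hence equalities and inequalities between measures are
   only ever required on measurable sets. *)
Record locFinMeasure (X : polishType R) := LocFinMeasure {
  lf_measure :> {measure set (borel X) -> \bar R} ;
  lf_finite : forall B : boundedBorel X, lf_measure B < +oo }.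

Record pointMeasure (X : polishType R) := PointMeasure {
  pm_measure :> locFinMeasure X ;
  pm_integer : forall B : boundedBorel X, exists n : nat, pm_measure B = n%:R%:E }.

Context {X : polishType R}.

HB.instance Definition _ := gen_eqMixin (locFinMeasure X).
HB.instance Definition _ := gen_choiceMixin (locFinMeasure X).
HB.instance Definition _ := gen_eqMixin (pointMeasure X).
HB.instance Definition _ := gen_choiceMixin (pointMeasure X).

Lemma lf_add_finite (mu nu : locFinMeasure X) (B : boundedBorel X) :
  measure_add mu nu B < +oo.
Proof. by rewrite measure_addE lte_add_pinfty ?lf_finite. Qed.

Definition lf_add (mu nu : locFinMeasure X) : locFinMeasure X :=
  LocFinMeasure (lf_add_finite mu nu).

Lemma pm_add_integer (mu nu : pointMeasure X) (B : boundedBorel X) :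
  exists n : nat, lf_add mu nu B = n%:R%:E.
Proof.
have [m mE] := pm_integer mu B; have [n nE] := pm_integer nu B.
by exists (m + n)%N; rewrite [LHS]measure_addE [X in X + _]mE [X in _ + X]nE natrD.
Qed.

Definition pm_add (mu nu : pointMeasure X) : pointMeasure X :=
  PointMeasure (pm_add_integer mu nu).

Lemma lf_zero_finite (B : boundedBorel X) :
  @mzero _ (borel X) R B < +oo.
Proof. by rewrite /mzero ltry. Qed.

Definition lf_zero : locFinMeasure X := LocFinMeasure lf_zero_finite.

Lemma pm_zero_integer (B : boundedBorel X) :
  exists n : nat, lf_zero B = n%:R%:E.
Proof. by exists 0%N. Qed.

Definition pm_zero : pointMeasure X := PointMeasure pm_zero_integer.

Lemma lf_dirac_finite (x : borel X) (B : boundedBorel X) :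
  (\d_x : set (borel X) -> \bar R) B < +oo.
Proof. by rewrite diracE ltry. Qed.

Definition lf_dirac (x : borel X) : locFinMeasure X :=
  LocFinMeasure (lf_dirac_finite x).

Lemma pm_dirac_integer (x : borel X) (B : boundedBorel X) :
  exists n : nat, lf_dirac x B = n%:R%:E.
Proof. by exists (x \in (B : set _)); rewrite /= diracE. Qed.

Definition pm_dirac (x : borel X) : pointMeasure X :=
  PointMeasure (pm_dirac_integer x).

(* the difference nu - mu, meaningful when mu <= nu *)
Definition pm_sub (nu mu : pointMeasure X) : pointMeasure X :=
  xget pm_zero [set xi : pointMeasure X |
    forall A, measurable A -> nu A = mu A + xi A].

Definition diffuse (rho : locFinMeasure X) := forall x : borel X, rho [set x] = 0.

End locally_finite_measures.

Section vague_topology.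
Local Open Scope ereal_scope.
Context {R : realType} (X : polishType R).

Record vagueTest := VagueTest {
  vt_fun :> X -> R ;
  vt_continuous : continuous vt_fun ;
  vt_bounded : exists M : R, forall x, (`|vt_fun x| <= M)%R ;
  vt_support : exists2 B : set X, bounded_subset B &
    forall x, ~ B x -> vt_fun x = 0%R }.

Definition vague_eval (mu : locFinMeasure X) :
    {ptws vagueTest -> \bar R} :=
  fun f => \int[mu]_x (f x)%:E.

HB.instance Definition _ :=
  Topological.copy (locFinMeasure X) (initial_topology vague_eval).

HB.instance Definition _ := Topological.copy (pointMeasure X)
  (initial_topology (@pm_measure R X : _ -> locFinMeasure X)).

End vague_topology.

(* The sigma-algebra on point measures is generated by the evaluations
   mu |-> mu B, B bounded Borel. *)
Section point_measures_measurable.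
Context {R : realType} (X : polishType R).

HB.instance Definition _ := isPointed.Build (pointMeasure X) pm_zero.

Definition pm_cylinder : set (set (pointMeasure X)) :=
  \bigcup_(B in [set: boundedBorel X])
    preimage_set_system setT (fun mu : pointMeasure X => mu B) (@measurable _ (\bar R)).

HB.instance Definition _ :=
  Measurable.copy (pointMeasure X) (g_sigma_algebraType pm_cylinder).

End point_measures_measurable.

(* Finite point measures on {1, 2, ...}, as measures on nat not charging 0. *)
Section finite_point_measures.
Local Open Scope ereal_scope.
Context (R : realType).

Record finPointMeasure := FinPointMeasure {
  fpm_measure :> {measure set nat -> \bar R} ;
  fpm_integer : forall A, exists n : nat, fpm_measure A = n%:R%:E ;
  fpm_zero : fpm_measure [set 0%N] = 0 }.

HB.instance Definition _ := gen_eqMixin finPointMeasure.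
HB.instance Definition _ := gen_choiceMixin finPointMeasure.

Lemma fpm_null_integer (A : set nat) :
  exists n : nat, @mzero _ nat R A = n%:R%:E.
Proof. by exists 0%N. Qed.

Definition fpm_null : finPointMeasure :=
  FinPointMeasure fpm_null_integer erefl.

HB.instance Definition _ := isPointed.Build finPointMeasure fpm_null.

Definition fpm_cylinder : set (set finPointMeasure) :=
  \bigcup_(A in [set: set nat])
    preimage_set_system setT (fun eta : finPointMeasure => eta A)
      (@measurable _ (\bar R)).

HB.instance Definition _ :=
  Measurable.copy finPointMeasure (g_sigma_algebraType fpm_cylinder).

Lemma fpm_add_integer (eta xi : finPointMeasure) (A : set nat) :
  exists n : nat, measure_add eta xi A = n%:R%:E.
Proof.
have [m mE] := fpm_integer eta A; have [n nE] := fpm_integer xi A.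
by exists (m + n)%N; rewrite measure_addE mE nE natrD.
Qed.

Lemma fpm_add_zero (eta xi : finPointMeasure) : measure_add eta xi [set 0%N] = 0.
Proof. by rewrite measure_addE !fpm_zero adde0. Qed.

Definition fpm_add (eta xi : finPointMeasure) : finPointMeasure :=
  FinPointMeasure (fpm_add_integer eta xi) (fpm_add_zero eta xi).

End finite_point_measures.

Section occupation.
Local Open Scope ereal_scope.
Context {R : realType} {X : polishType R}.

Definition atoms (B : boundedBorel X) (mu : pointMeasure X) (j : nat) :
    set (borel X) :=
  [set x | (B : set _) x /\ mu [set x] = j%:R%:E].

Lemma measurable_point (x : borel X) : measurable [set x].
Proof.
rewrite -[[set x]]setCK; apply: measurableC; apply: sub_sigma_algebra.
apply: closed_openC.
exact: (@accessible_closed_set1 X (hausdorff_accessible (@metric_hausdorff R X)) x).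
Qed.

Lemma atoms_finite B mu j : (0 < j)%N -> finite_set (atoms B mu j).
Proof.
move=> j0; have [N NE] := pm_integer mu B.
apply: contrapT => /(infinite_set_fset N.+1)[D DB DN].
have mD i : [set` D] i -> measurable [set (i : borel X)].
  by move=> _; exact: measurable_point.
have tD : trivIset [set` D] (fun i : borel X => [set i]).
  by move=> x y _ _ [z [/= -> ->]].
have DE : \bigcup_(i in [set` D]) [set i] = [set` D].
  by rewrite bigcup_imset1 image_id.
have mDD : measurable ([set` D] : set (borel X)).
  by have := fin_bigcup_measurable (finite_fset D) mD; rewrite DE.
have := @measure_fin_bigcup _ _ _ mu _ _ _ (finite_fset D) tD mD.
rewrite DE => muD.
have : mu [set` D] <= mu B.
  apply: le_measure; [exact: mem_set| |by move=> x /DB[]].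
  by apply: mem_set; exact: bb_measurable.
rewrite muD NE (eq_fsbigr (fun _ => j%:R%:E)); last first.
  by move=> x /set_mem /DB[].
rewrite fsbig_finite//= set_fsetK -(big_map (fun=> j%:R) xpredT (fun x : R => x%:E)).
rewrite sumEFin lee_fin big_map big_const_seq count_predT.
have -> : forall n, iter n (+%R (j%:R : R)) 0%R = (n * j)%:R.
  by elim=> [|n IH] /=; rewrite ?mul0n// IH -natrD mulSn.
rewrite ler_nat leqNgt => /negP; apply.
by rewrite (leq_trans DN)// leq_pmulr.
Qed.

(* the number of x in B with mu {x} = j; finite by atoms_finite *)
Definition occupation B mu j : nat :=
  if j is 0%N then 0%N else #|` fset_set (atoms B mu j)|%fset.

Definition U_measure B mu : {measure set nat -> \bar R} :=
  mseries (fun j => mscale (occupation B mu j)%:R%:nng%R \d_j) 0.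

Lemma U_integer B mu (A : set nat) : exists n : nat, U_measure B mu A = n%:R%:E.
Proof.
have [N NE] := pm_integer mu B.
rewrite /U_measure /= /mseries (nneseries_split 0 N.+1); last first.
  by move=> k _; rewrite measure_ge0.
rewrite add0n [X in _ + X]eseries0 ?adde0; last first.
  move=> k Nk _; rewrite /= /mscale /= /occupation; case: k Nk => // k Nk.
  suff -> : atoms B mu k.+1 = set0 by rewrite fset_set0 cardfs0 mul0e.
  apply/seteqP; split=> // x [Bx mux].
  have : mu [set x] <= mu B.
    apply: le_measure; last by move=> _ ->.
      by apply: mem_set; exact: measurable_point.
    by apply: mem_set; exact: bb_measurable.
  by rewrite mux NE lee_fin ler_nat leqNgt Nk.
exists (\sum_(0 <= k < N.+1) occupation B mu k * (k \in A))%N.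
rewrite natr_sum -sumEFin; apply: eq_bigr => k _.
by rewrite /= /mscale /= diracE natrM EFinM.
Qed.

Lemma U_zero B mu : U_measure B mu [set 0%N] = 0.
Proof.
rewrite /U_measure /= /mseries eseries0// => k _ _; rewrite /= /mscale /=.
case: k => [|k]; first by rewrite mul0e.
by rewrite diracE memNset ?mule0.
Qed.

Definition U (B : boundedBorel X) (mu : pointMeasure X) : finPointMeasure R :=
  FinPointMeasure (U_integer B mu) (U_zero B mu).

End occupation.

Section polya_sum.
Local Open Scope ereal_scope.
Context {R : realType} {X : polishType R}.

Definition polya_sum_equation (z : R) (kappa : locFinMeasure X)
    (P : set (pointMeasure X) -> \bar R) :=
  forall h : borel X * pointMeasure X -> \bar R,
    measurable_fun setT h -> (forall u, 0 <= h u) ->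
    \int[P]_mu \int[mu]_x h (x, mu) =
    \int[P]_mu (z%:E * \int[lf_add kappa mu]_x h (x, pm_add mu (pm_dirac x))).

(* P is the law S_{z,kappa} *)
Definition is_polya_sum (z : R) (kappa : locFinMeasure X)
    (P : {measure set (pointMeasure X) -> \bar R}) :=
  [/\ P setT = 1, polya_sum_equation z kappa P &
    forall Q : probability (pointMeasure X) R, polya_sum_equation z kappa Q ->
      forall A, measurable A -> Q A = P A].

(* law of the sum of two independent point processes with laws P and Q *)
Definition pm_convolution (P Q : probability (pointMeasure X) R) :=
  pushforward (P \x Q) (fun m => pm_add m.1 m.2).

End polya_sum.

(* Stochastic processes are families indexed by R, considered on [0, 1). *)
Section markov_processes.
Local Open Scope ereal_scope.
Context {R : realType} {d d' : measure_display} {Omega : measurableType d}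
  {T : measurableType d'} (P : probability Omega R) (Z : R -> Omega -> T).

Definition past (s : R) : set (set Omega) :=
  <<s [set Z r @^-1` A | r in `[0%R, s] & A in measurable] >>.

Definition is_process := forall t : R, (0 <= t < 1)%R -> measurable_fun setT (Z t).

(* the conditional probability of {Z t in A} given the past up to s is a
   function of Z s *)
Definition markov_process := is_process /\
  forall s t : R, (0 <= s)%R -> (s < t)%R -> (t < 1)%R ->
  forall A, measurable A -> exists g : T -> \bar R,
    [/\ measurable_fun setT g, forall x, 0 <= g x &
      forall G, past s G ->
        P (G `&` Z t @^-1` A) = \int[P]_(w in G) g (Z s w)].

Definition transition_kernel (s t : R) (p : R.-pker T ~> T) :=
  forall A G, measurable A -> past s G ->
    P (G `&` Z t @^-1` A) = \int[P]_(w in G) p (Z s w) A.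

End markov_processes.

(* K is a regular version of the conditional law of V given W *)
Definition conditional_law {R : realType} {d d1 d2 : measure_display}
    {Omega : measurableType d} {T1 : measurableType d1} {T2 : measurableType d2}
    (P : probability Omega R) (V : Omega -> T2) (W : Omega -> T1)
    (K : R.-pker T1 ~> T2) :=
  forall A C, measurable A -> measurable C ->
    P (W @^-1` C `&` V @^-1` A) = (\int[P]_(w in W @^-1` C) K (W w) A)%E.

Section chinese_restaurant.
Local Open Scope ereal_scope.
Context {R : realType} {X : polishType R} {d : measure_display}
  {Omega : measurableType d} (P : probability Omega R).

Record chinese_restaurant (rho : locFinMeasure X)
    (Y : R -> Omega -> pointMeasure X) : Prop := ChineseRestaurant {
  cr_markov : markov_process P Y ;
  cr_zero : forall w A, measurable A -> Y 0%R w A = 0 ;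
  cr_increasing : forall (s t : R) w A, (0 <= s)%R -> (s <= t)%R -> (t < 1)%R ->
    measurable A -> Y s w A <= Y t w A ;
  cr_right_continuous : forall (t : R) w, (0 <= t < 1)%R ->
    Y u w @[u --> t^'+] --> Y t w ;
  cr_left_limit : forall (t : R) w, (0 < t < 1)%R ->
    exists nu : pointMeasure X, Y u w @[u --> t^'-] --> nu ;
  cr_increment : forall s t : R, (0 <= s)%R -> (s < t)%R -> (t < 1)%R ->
    exists K : R.-pker (pointMeasure X) ~> (pointMeasure X),
      conditional_law P (fun w => pm_sub (Y t w) (Y s w)) (Y s) K /\
      {ae pushforward P (Y s), forall nu : pointMeasure X,
        is_polya_sum ((t - s) / (1 - s)) (lf_add rho nu) (K nu)} }.

End chinese_restaurant.

(* Main.v *)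
Require Import Defs.
From HB Require Import structures.
From mathcomp Require Import all_boot all_order all_algebra.
From mathcomp Require Import all_classical all_reals all_analysis.
From mathcomp Require Import finmap measurable_realfun.

Set Implicit Arguments.
Unset Strict Implicit.
Unset Printing Implicit Defensive.

Import Order.TTheory GRing.Theory Num.Theory.
Import numFieldNormedType.Exports.

Local Open Scope classical_set_scope.
Local Open Scope ring_scope.

(** Given Y_s = nu, the increment mu = Y_t - Y_s has law S_(z, rho + nu) with
    z = (t - s) / (1 - s).  A point measure is purely atomic (pm_atom) and rho is
    diffuse, so that the countable set D of the atoms of nu splits the
    intensity: rho + nu is nu on D and rho off D.  Correspondingly mu splits
    into its restrictions to D and to the complement of D, which are independent
    with laws S_(z, nu) and S_(z, rho).  The second one creates new atoms, the
    first one enlarges the atoms of nu, and no point is an atom of both; hence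
    U_B (nu + mu) is the sum of U_B (mu off D) and U_B (nu + mu on D), which is
    the announced mixture (block_lawE).

    The law of U_B (nu + mu on D) depends on nu through U_B nu alone: if nu and
    nu' have the same occupation numbers, some bijection between their atoms in
    B preserves multiplicities (relabelling_exists); it carries the solution for
    the atoms of nu in B to the one for the atoms of nu' in B and does not
    change the occupation numbers (U_relabel, old_law_unique).

    All facts about the laws S are drawn from the defining equation: its
    solutions are stable under images (polya_transport) and under convolution
    (polya_convolution), and they do not charge null sets of the intensity
    (polya_null).  Hence uniqueness for an intensity is inherited by its
    restrictions (is_polya_sum_restriction), and the existence and uniqueness of
    S_(z, rho + nu) yield those of S_(z, rho) and S_(z, nu) together with the
    independence of the two parts (is_polya_sum_split).

    The transition law is thus a function of U_B nu, and it is a kernel because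
    the finite point measures form a countable discrete space (fpm_discrete).
    The occupation numbers are measurable, being integrals of functions of the
    multiplicity (occupation_measure).  Finally, the conditional law of Y_t - Y_s
    given Y_s extends to a joint law (conditional_law_joint), so that the
    conditional probability that the Markov property of Y attaches to an event
    of U_B (Y_t) is the kernel at U_B (Y_s) almost surely. *)

(** * Measurability of point measures *)

Lemma bigcup_countable_measurable d (T : measurableType d) I (D : set I)
    (F : I -> set T) : countable D -> (forall i, D i -> measurable (F i)) ->
  measurable (\bigcup_(i in D) F i).
Proof.
move=> cD mF; have [->|[e]] := pfcard_geP cD; first by rewrite bigcup_set0.
rewrite (_ : \bigcup_(i in D) F i = \bigcup_n F (e n)).
  by apply: bigcupT_measurable => n; apply: mF; exact: funS.
apply/seteqP; split=> [x [i /(@surj _ _ _ _ e)[n _ <-] Fx]|x [n _ Fx]].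
  by exists n.
by exists (e n) => //; exact: funS.
Qed.

Lemma eq_indic (R : pzRingType) T T' (A : set T) (A' : set T') t t' :
  (A t <-> A' t') -> \1_A t = \1_A' t' :> R.
Proof.
move=> AA'; rewrite !indicE; congr (nat_of_bool _)%:R.
by apply/idP/idP => /set_mem h; apply: mem_set; apply/AA'.
Qed.

Lemma measure_bigcupT d (T : measurableType d) (R : realType)
    (mu : {measure set T -> \bar R}) (F : (set T)^nat) :
  (forall n, measurable (F n)) -> trivIset setT F ->
  mu (\bigcup_n F n) = (\sum_(n <oo) mu (F n))%E.
Proof.
move=> mF tF; rewrite measure_bigcup//.
by apply: eq_eseriesl => n; rewrite in_setT.
Qed.

Section bounded_exhaustion.
Context {R : realType} (X : polishType R).

Lemma mball_open (x : X) (r : R) : open (ball x r).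
Proof.
rewrite openE => y; rewrite ballEmdist /= => xy.
have r0 : 0 < r - mdist x y by rewrite subr_gt0.
apply: (filterS _ (nbhsx_ballx y _ r0)) => z.
rewrite !ballEmdist /= ltrBrDl => yz.
exact: le_lt_trans (metric_triangle x y z) yz.
Qed.

Lemma measurable_mball (x : X) (r : R) : measurable (ball x r : set (borel X)).
Proof. by apply: sub_sigma_algebra; exact: mball_open. Qed.

Definition bigball (n : nat) : set (borel X) := ball (point : X) n%:R.

Lemma measurable_bigball n : measurable (bigball n).
Proof. exact: measurable_mball. Qed.

Lemma bounded_bigball (B : set (borel X)) :
  @bounded_subset R X B -> exists n, B `<=` bigball n.
Proof.
move=> [x [r Br]].
exists (Num.Def.archi_bound (mdist (point : X) x + r)) => y /Br.
rewrite /bigball !ballEmdist /= => xy.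
apply: (le_lt_trans (metric_triangle _ x _)).
apply: (@lt_le_trans _ _ (mdist (point : X) x + r)); first by rewrite ltrD2l.
have [z0|z0] := leP 0 (mdist (point : X) x + r).
  exact/ltW/archi_boundP.
by apply: (le_trans (ltW z0)); rewrite ler0n.
Qed.

Lemma bigball_bounded n : @bounded_subset R X (bigball n).
Proof. by exists point, n%:R. Qed.

Lemma bigcup_bigball : \bigcup_n bigball n = setT.
Proof.
apply/seteqP; split=> // x _.
have [|n xn] := @bounded_bigball [set x]; last by exists n => //; exact: xn.
by exists x, 1 => _ ->; exact: ballxx.
Qed.

Definition annulus : (set (borel X))^nat := seqDU bigball.

Lemma measurable_annulus n : measurable (annulus n).
Proof.
apply: measurableD; first exact: measurable_bigball.
by apply: bigsetU_measurable => i _; exact: measurable_bigball.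
Qed.

Lemma bigcup_annulus : \bigcup_n annulus n = setT.
Proof. by rewrite -seqDU_bigcup_eq bigcup_bigball. Qed.

Lemma bounded_subsetS (A B : set (borel X)) : A `<=` B ->
  @bounded_subset R X B -> @bounded_subset R X A.
Proof. by move=> AB [x [r Br]]; exists x, r => y /AB /Br. Qed.

Lemma bounded_annulus n : @bounded_subset R X (annulus n).
Proof.
by apply: bounded_subsetS (bigball_bounded n); exact: subset_seqDU.
Qed.

Lemma bounded_point (x : borel X) : @bounded_subset R X [set x].
Proof. by exists (x : X), 1 => _ ->; exact: ballxx. Qed.

Definition bb_point (x : borel X) : boundedBorel X :=
  BoundedBorel (measurable_point x) (bounded_point x).

Definition bb_restr (A : set (borel X)) (mA : measurable A) (B : boundedBorel X) :
    boundedBorel X :=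
  BoundedBorel (measurableI _ _ mA (bb_measurable B))
    (bounded_subsetS (@subIsetr _ _ _) (bb_bounded B)).

Definition bb_annulus n : boundedBorel X :=
  BoundedBorel (measurable_annulus n) (bounded_annulus n).

Definition bb_bigball n : boundedBorel X :=
  BoundedBorel (measurable_bigball n) (bigball_bounded n).

Local Open Scope ereal_scope.

Lemma measure_annulus (mu : {measure set (borel X) -> \bar R}) A :
  measurable A -> mu A = \sum_(n <oo) mu (A `&` annulus n).
Proof.
move=> mA; rewrite -[in LHS](setIT A) -bigcup_annulus setI_bigcupr.
rewrite measure_bigcupT//.
- by move=> n; apply: measurableI => //; exact: measurable_annulus.
- apply: trivIset_setIl; exact: trivIset_seqDU.
Qed.

End bounded_exhaustion.

Section point_measure_basics.
Context {R : realType} {X : polishType R}.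
Local Open Scope ereal_scope.
Implicit Types (mu nu : pointMeasure X).

Lemma lf_ext (kap kap' : locFinMeasure X) : (forall A, kap A = kap' A) -> kap = kap'.
Proof.
move: kap kap' => [m f] [m' f'] /= mm'.
have : m = m' by apply: eq_measure; exact/funext.
by move=> E; subst m'; congr LocFinMeasure; exact: Prop_irrelevance.
Qed.

Lemma pm_ext mu nu : (forall A, mu A = nu A) -> mu = nu.
Proof.
move: mu nu => [m f] [m' f'] /= mm'.
have E : m = m' by exact: lf_ext.
by subst m'; congr PointMeasure; exact: Prop_irrelevance.
Qed.

Lemma lf_addE (kap kap' : locFinMeasure X) A : lf_add kap kap' A = kap A + kap' A.
Proof. exact: measure_addE. Qed.

Lemma pm_addE mu nu A : pm_add mu nu A = mu A + nu A.
Proof. exact: measure_addE. Qed.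

Lemma pm_fin_num mu (B : boundedBorel X) : mu B \is a fin_num.
Proof. by have [n ->] := pm_integer mu B. Qed.

Lemma measurable_fun_pm d (T : measurableType d) (g : T -> pointMeasure X) :
  (forall B : boundedBorel X, measurable_fun setT (fun t => g t B)) ->
  measurable_fun setT g.
Proof.
move=> mg; apply: (measurability (@pm_cylinder R X)) => //.
move=> _ [_ [B _ [C mC <-]] <-]; rewrite !setTI.
by rewrite -[X in measurable X]setTI; exact: mg.
Qed.

Lemma measurable_eval_bb (B : boundedBorel X) :
  measurable_fun setT (fun mu : pointMeasure X => mu B).
Proof.
move=> _ C mC; rewrite setTI; apply: sub_sigma_algebra.
by exists B => //; exists C => //; rewrite setTI.
Qed.

Lemma measurable_eval (A : set (borel X)) : measurable A ->
  measurable_fun setT (fun mu : pointMeasure X => mu A).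
Proof.
move=> mA.
rewrite (_ : (fun mu => _) =
    fun mu : pointMeasure X => \sum_(n <oo) mu (bb_restr mA (bb_annulus X n))).
  by apply: ge0_emeasurable_sum => // n _; exact: measurable_eval_bb.
by apply/funext => mu; rewrite measure_annulus.
Qed.

(** Point measures that differ on nonmeasurable sets only are distinct terms; no
    measurable set of point measures tells them apart. *)
Lemma pm_indistinguishable mu nu (A : set (pointMeasure X)) :
  (forall B : boundedBorel X, mu B = nu B) -> measurable A -> A mu -> A nu.
Proof.
move=> mn mA.
suff H : measurable `<=` [set A : set (pointMeasure X) | A mu <-> A nu].
  by case: (H _ mA).
apply: smallest_sub => [|_ [B _ [C mC <-]]]; last by rewrite /= mn.
split=> [//=|C /= [H1 H2]|F /= HF].
- by tauto.
- by split=> -[n _ Fn]; exists n => //; case: (HF n) => h1 h2; tauto.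
Qed.

Lemma measurable_pm_add d (T : measurableType d) (f g : T -> pointMeasure X) :
  measurable_fun setT f -> measurable_fun setT g ->
  measurable_fun setT (fun t => pm_add (f t) (g t)).
Proof.
move=> mf mg; apply: measurable_fun_pm => B.
rewrite (_ : (fun t => _) = (fun t => f t B) \+ (fun t => g t B)).
  apply: emeasurable_funD.
  - exact: (measurableT_comp (measurable_eval_bb B) mf).
  - exact: (measurableT_comp (measurable_eval_bb B) mg).
by apply/funext => t; rewrite pm_addE.
Qed.

Lemma measurable_pm_dirac d (T : measurableType d) (f : T -> borel X) :
  measurable_fun setT f -> measurable_fun setT (fun t => pm_dirac (f t)).
Proof.
move=> mf; apply: measurable_fun_pm => B.
rewrite (_ : (fun t => _) = EFin \o (\1_(B : set _) \o f)).
  apply/measurable_EFinP; apply: measurableT_comp mf.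
  exact: (measurable_indic (bb_measurable B)).
by apply/funext => t /=; rewrite diracE.
Qed.

End point_measure_basics.

(** * Multiplicities of points *)

Section point_measure_kernels.
Context {R : realType} {X : polishType R} {d : measure_display}
  {T : measurableType d}.
Variables (kap : locFinMeasure X) (g : T -> pointMeasure X).
Hypothesis mg : measurable_fun setT g.
Local Open Scope ereal_scope.

Definition shift_kernel (t : T) : {measure set (borel X) -> \bar R} :=
  lf_add kap (g t).

Lemma measurable_shift_kernel A : measurable A ->
  measurable_fun setT (shift_kernel ^~ A).
Proof.
move=> mA; rewrite (_ : (fun t => _) = cst (kap A) \+ (fun t => g t A)).
  apply: emeasurable_funD; first exact: measurable_cst.
  exact: (measurableT_comp (measurable_eval mA) mg).
by apply/funext => t; rewrite /shift_kernel lf_addE.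
Qed.

Import HBNNSimple.

HB.instance Definition _ :=
  isKernel.Build _ _ _ _ _ shift_kernel measurable_shift_kernel.

(** Integrals against a locally finite kernel depend measurably on the
    parameter: each annulus only sees a finite measure. *)
Lemma measurable_fun_integral_pm (f : T * borel X -> \bar R) :
  measurable_fun setT f -> (forall u, 0 <= f u) ->
  measurable_fun setT (fun t => \int[lf_add kap (g t)]_x f (t, x)).
Proof.
move=> mf f0.
pose f_ := nnsfun_approx measurableT mf.
apply: (@measurable_fun_xsection_integral _ _ _ _ _ _ shift_kernel f_).
- by move=> a b ab; exact/nd_nnsfun_approx.
- by move=> z; exact/cvg_nnsfun_approx.
- move=> n r; set S := f_ n @^-1` [set r].
  have mS : measurable S by exact: measurable_sfunP.
  rewrite (_ : (fun x => _) = (fun t => \sum_(m <oo)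
      mrestr (shift_kernel t) (@measurable_annulus R X m) (xsection S t))); last first.
    by apply/funext => t; apply: measure_annulus; exact: measurable_xsection.
  apply: ge0_emeasurable_sum => [m t _ _|m _].
    exact: measure_ge0.
  pose k : R.-ker T ~> borel X := shift_kernel.
  apply: (@measurable_prod_subset_xsection_kernel _ _ _ _ _ k _
    (@measurable_annulus R X m) _ _ mS).2 => t.
  exists (fine (lf_add kap (g t) (annulus m)) + 1)%R => A mA.
  apply: (@le_lt_trans _ _ (shift_kernel t (annulus m))).
    rewrite /mrestr; apply: le_measure => //; apply: mem_set.
      by apply: measurableI => //; exact: measurable_annulus.
    exact: measurable_annulus.
  rewrite /shift_kernel -[X in X < _]fineK.
    by rewrite lte_fin ltrDl.
  by rewrite ge0_fin_numE//; exact: (lf_finite _ (bb_annulus X m)).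
Qed.

End point_measure_kernels.

Section multiplicity.
Context {R : realType} {X : polishType R}.
Local Open Scope ereal_scope.

Lemma dense_sequence : exists e : nat -> X, forall (r : R) (x : X), (0 < r)%R ->
  exists k, ball (e k) r x.
Proof.
have [D cD dD] := @separable _ X.
have [D0|[e]] := pfcard_geP cD.
  have [|//|x []] := dD setT; last by rewrite D0.
  - by exists point.
  - exact: openT.
exists e => r x r0; have [||q [qx Dq]] := dD (ball x r).
- by exists x; exact: ballxx.
- exact: mball_open.
by have [k _ kq] := @surj _ _ _ _ e q Dq; exists k; rewrite kq; exact: ball_sym.
Qed.

Lemma small_inverse (r : R) : (0 < r)%R -> exists n : nat, (2 * n.+1%:R^-1 < r)%R.
Proof.
move=> r0; exists (Num.Def.archi_bound (2 / r)).
rewrite ltr_pdivrMr// mulrC -ltr_pdivrMr//.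
apply: (@lt_trans _ _ (Num.Def.archi_bound (2 / r))%:R).
  by apply: archi_boundP; rewrite divr_ge0// ltW.
by rewrite ltr_nat.
Qed.

(** Two points are equal as soon as, for every n, some term of a dense sequence
    is within 1/n of both: this is where separability enters the measurability
    of multiplicities. *)
Lemma measurable_diagonal : measurable [set u : borel X * borel X | u.1 = u.2].
Proof.
have [e eP] := dense_sequence.
have -> : [set u : borel X * borel X | u.1 = u.2] =
    \bigcap_n \bigcup_k
      ((ball (e k) n.+1%:R^-1 : set (borel X)) `*`
       (ball (e k) n.+1%:R^-1 : set (borel X))).
  apply/seteqP; split=> [[x _] /= <- n _|[x y] /= xy].
    have [|k xk] := eP n.+1%:R^-1%R x; first by rewrite invr_gt0.
    by exists k.
  apply: contrapT => /eqP nxy.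
  have d0 : (0 < mdist (x : X) y)%R by rewrite mdist_gt0.
  have [n nd] := small_inverse d0.
  have [k _ [/= /ball_sym xk ky]] := xy n I.
  have := ball_triangle xk ky; rewrite ballEmdist /=.
  have <- : (2 * n.+1%:R^-1 = n.+1%:R^-1 + n.+1%:R^-1 :> R)%R.
    by rewrite mulr_natl mulr2n.
  by move=> /(lt_trans nd); rewrite ltxx.
apply: bigcap_measurable; first by exists 0%N.
by move=> n _; apply: bigcupT_measurable => k;
  apply: measurableX; exact: measurable_mball.
Qed.

Lemma pm_finite_sum (mu : pointMeasure X) (F : set (borel X)) : finite_set F ->
  mu F = \sum_(x \in F) mu [set x].
Proof.
move=> fF; rewrite -[in LHS](image_id F) -bigcup_imset1.
apply: measure_fin_bigcup => //.
- by move=> x y _ _ [z [/= -> ->]].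
- by move=> x _; exact: measurable_point.
Qed.

Lemma lf_add0 (mu : pointMeasure X) : lf_add lf_zero mu = mu.
Proof. by apply: lf_ext => A; rewrite lf_addE /= /mzero add0e. Qed.

Lemma measurable_mass :
  measurable_fun setT (fun u : borel X * pointMeasure X => u.2 [set u.1]).
Proof.
rewrite (_ : (fun u => _) = fun u : borel X * pointMeasure X =>
    \int[lf_add lf_zero u.2]_y
      (\1_[set v : borel X * borel X | v.1 = v.2] (u.1, y))%:E).
  apply: (@measurable_fun_integral_pm _ _ _ _ _ snd measurable_snd
    (fun w => (\1_[set v : borel X * borel X | v.1 = v.2] (w.1.1, w.2))%:E)).
    apply/measurable_EFinP.
    apply: (measurableT_comp (measurable_indic measurable_diagonal)).
    apply: measurable_fun_pair; last exact: measurable_snd.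
    exact: measurableT_comp measurable_fst measurable_fst.
  by move=> w; rewrite lee_fin.
apply/funext => -[x mu]; rewrite lf_add0 /=.
rewrite -[in LHS](setIT [set x]) -integral_indic//; last exact: measurable_point.
apply: eq_integral => y _; congr (_%:E); apply: eq_indic.
by split=> /= ->.
Qed.

(** The occupation numbers are integrals of the multiplicity: a point of
    multiplicity j carries mass j, so that the number of such points in B is
    1/j times the mass of the set they form. *)
Lemma occupation_measure (B : boundedBorel X) (mu : pointMeasure X) j :
  mu (atoms B mu j.+1) = (occupation B mu j.+1 * j.+1)%N%:R%:E.
Proof.
have fA := atoms_finite B mu (ltn0Sn j); rewrite (pm_finite_sum _ fA).
rewrite (eq_fsbigr (fun _ => j.+1%:R%:E)); last by move=> x /set_mem[].
rewrite fsbig_finite//= -(big_map (fun=> j.+1%:R) xpredT (fun x : R => x%:E)).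
rewrite sumEFin big_map big_const_seq count_predT natrM; congr (_%:E).
by rewrite iter_addr_0 mulr_natl.
Qed.

Lemma measurable_occupation (B : boundedBorel X) j :
  measurable_fun setT (fun mu : pointMeasure X => (occupation B mu j)%:R%:E : \bar R).
Proof.
case: j => [|j]; first by rewrite /occupation; exact: measurable_cst.
pose S := [set u : pointMeasure X * borel X |
  (B : set _) u.2 /\ u.1 [set u.2] = j.+1%:R%:E].
have mS : measurable S.
  have -> : S = (snd @^-1` (B : set _)) `&`
      ((fun u : pointMeasure X * borel X => u.1 [set u.2]) @^-1` [set j.+1%:R%:E]).
    by [].
  apply: measurableI; rewrite -[X in measurable X]setTI.
    by apply: measurable_snd => //; exact: bb_measurable.
  have mm : measurable_fun setT (fun u : pointMeasure X * borel X => u.1 [set u.2]).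
    exact: (measurableT_comp measurable_mass
      (@measurable_swap _ _ (pointMeasure X) (borel X))).
  exact: mm.
rewrite (_ : (fun mu => _) = fun mu : pointMeasure X =>
    (j.+1%:R^-1)%:E * \int[lf_add lf_zero mu]_x (\1_S (mu, x))%:E).
  apply: measurable_funeM.
  apply: (@measurable_fun_integral_pm _ _ _ _ _ idfun _ (EFin \o \1_S)).
  - exact: measurable_id.
  - by apply/measurable_EFinP; exact: measurable_indic.
  - by move=> w; rewrite lee_fin.
apply/funext => mu; rewrite lf_add0.
have -> : \int[mu]_x (\1_S (mu, x))%:E = mu (atoms B mu j.+1).
  rewrite -[in RHS](setIT (atoms B mu j.+1)) -integral_indic//; last first.
    have -> : atoms B mu j.+1 = xsection S mu.
      by apply/seteqP; split=> y; [exact: mem_set|exact: set_mem].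
    exact: measurable_xsection.
rewrite occupation_measure -EFinM; congr (_%:E).
by rewrite natrM mulrC mulfK// pnatr_eq0.
Qed.

End multiplicity.

(** * Finite point measures and occupation numbers *)

Section finite_point_measures.
Context {R : realType}.
Local Open Scope ereal_scope.
Implicit Types eta xi : finPointMeasure R.

Lemma fpm_ext eta xi : (forall A, eta A = xi A) -> eta = xi.
Proof.
move: eta xi => [m f g] [m' f' g'] /= mm'.
have : m = m' by apply: eq_measure; exact/funext.
by move=> E; subst m'; congr FinPointMeasure; exact: Prop_irrelevance.
Qed.

Lemma fpm_ext1 eta xi : (forall j, eta [set j] = xi [set j]) -> eta = xi.
Proof.
move=> ex; apply: fpm_ext => A.
have AE : \bigcup_(i in A) [set i] = A by rewrite bigcup_imset1 image_id.
rewrite -AE !measure_bigcup//; try by move=> i j _ _ [z [/= -> ->]].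
by apply: eq_eseriesr => j _.
Qed.

Lemma fpm_addE eta xi A : fpm_add eta xi A = eta A + xi A.
Proof. exact: measure_addE. Qed.

Lemma measurable_fpm_eval A :
  measurable_fun setT (fun eta : finPointMeasure R => eta A).
Proof.
move=> _ C mC; rewrite setTI; apply: sub_sigma_algebra.
by exists A => //; exists C => //; rewrite setTI.
Qed.

Lemma measurable_fun_fpm d (T : measurableType d) (g : T -> finPointMeasure R) :
  (forall A, measurable_fun setT (fun t => g t A)) -> measurable_fun setT g.
Proof.
move=> mg; apply: (measurability (@fpm_cylinder R)) => //.
move=> _ [_ [A _ [C mC <-]] <-]; rewrite !setTI.
by rewrite -[X in measurable X]setTI; exact: mg.
Qed.

Lemma measurable_fpm_add :
  measurable_fun setT
    (fun u : finPointMeasure R * finPointMeasure R => fpm_add u.1 u.2).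
Proof.
apply: measurable_fun_fpm => A.
rewrite (_ : (fun u => _) = (fun u : finPointMeasure R * finPointMeasure R => u.1 A)
    \+ (fun u : finPointMeasure R * finPointMeasure R => u.2 A)).
  apply: emeasurable_funD.
  - exact: measurableT_comp (measurable_fpm_eval A) measurable_fst.
  - exact: measurableT_comp (measurable_fpm_eval A) measurable_snd.
by apply/funext => u; rewrite fpm_addE.
Qed.

Lemma measurable_fpm_set1 eta : measurable [set eta].
Proof.
have -> : [set eta] = \bigcap_j (fun xi : finPointMeasure R => xi [set j]) @^-1` [set eta [set j]].
  by apply/seteqP; split=> [_ -> j _|xi h] //; apply: fpm_ext1 => j; exact: h.
apply: bigcap_measurable; first by exists 0%N.
by move=> j _; rewrite -[X in measurable X]setTI; exact: measurable_fpm_eval.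
Qed.

(** The mass of the tail from N on decreases to 0 and is an integer. *)
Lemma fpm_bounded_support eta : exists N, forall j, (N <= j)%N -> eta [set j] = 0.
Proof.
have e0 : eta (\bigcap_n [set j | (n <= j)%N]) = 0.
  rewrite (_ : \bigcap_n _ = set0) ?measure0//.
  by apply/seteqP; split=> // j /(_ j.+1 I) /=; rewrite ltnn.
have H : eta \o (fun n => [set j | (n <= j)%N]) @ \oo --> 0.
  rewrite -e0; apply: nonincreasing_cvg_mu => //.
  - by have [n ->] := fpm_integer eta [set j | (0 <= j)%N]; exact: ltry.
  - by move=> m n mn; apply/subsetPset => j; exact: leq_trans.
have /H[N _ HN] : nbhs (0 : \bar R) [set x | x < 1].
  by apply: open_nbhs_nbhs; split; [exact: open_ereal_lt_ereal|rewrite /= lte01].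
exists N => j Nj; apply/eqP; rewrite eq_le measure_ge0 andbT.
apply: (@le_trans _ _ (eta [set k | (N <= k)%N])).
  by apply: le_measure; [exact: mem_set|exact: mem_set|move=> _ ->].
have := HN N (leqnn N) => /=; have [n ->] := fpm_integer eta [set k | (N <= k)%N].
by rewrite lte_fin (ltr_nat _ n 1) ltnS leqn0 => /eqP ->.
Qed.

Lemma countable_fpm : countable [set: finPointMeasure R].
Proof.
have val eta j : {n : nat | eta [set j] = n%:R%:E}.
  exact: cid (fpm_integer eta [set j]).
have sup eta : {N | forall j, (N <= j)%N -> eta [set j] = 0}.
  exact: cid (fpm_bounded_support eta).
apply/countable_injP.
exists (fun eta => choice.pickle [seq projT1 (val eta j) | j <- iota 0 (projT1 (sup eta))]).
move=> eta xi _ _ /(pcan_inj choice.pickleK) E; apply: fpm_ext1 => j.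
have Es : projT1 (sup eta) = projT1 (sup xi).
  by have := congr1 size E; rewrite !size_map !size_iota.
have [jN|Nj] := ltnP j (projT1 (sup eta)).
  have := congr1 (fun s => nth 0%N s j) E.
  rewrite !(nth_map 0%N) ?size_iota -?Es// !nth_iota -?Es// add0n.
  by move=> En; rewrite [LHS](projT2 (val eta j)) [RHS](projT2 (val xi j)) En.
by rewrite (projT2 (sup eta))// (projT2 (sup xi))// -Es.
Qed.

(** The state space is countable with measurable points, hence discrete. *)
Lemma fpm_discrete (A : set (finPointMeasure R)) : measurable A.
Proof.
rewrite -[A]image_id -bigcup_imset1; apply: bigcup_countable_measurable.
  by apply: sub_countable countable_fpm; exact: subset_card_le.
by move=> eta _; exact: measurable_fpm_set1.
Qed.

End finite_point_measures.

Section occupation_measure.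
Context {R : realType} {X : polishType R}.
Local Open Scope ereal_scope.
Implicit Types (mu nu : pointMeasure X) (B : boundedBorel X).

Lemma U_set1 B mu j : U B mu [set j] = (occupation B mu j)%:R%:E.
Proof.
rewrite /U /= /mseries (@nneseriesD1 _ _ j)//.
  rewrite /= /mscale /= diracE mem_set// mule1 eseries0 ?adde0//.
  move=> k _ /= kj; rewrite /mscale /= diracE memNset ?mule0// => jk.
  by move: kj; rewrite jk eqxx.
Qed.

Lemma eq_U B B' mu nu : (forall j, occupation B mu j = occupation B' nu j) ->
  U B mu = U B' nu.
Proof. by move=> E; apply: fpm_ext1 => j; rewrite !U_set1 E. Qed.

Lemma U_inj_occupation B B' mu nu j :
  U B mu = U B' nu -> occupation B mu j = occupation B' nu j.
Proof.
move=> E; have := congr1 (fun eta : finPointMeasure R => eta [set j]) E.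
by rewrite !U_set1 => -[] /eqP; rewrite eqr_nat => /eqP.
Qed.

Lemma eq_U_mass B mu nu :
  (forall x, (B : set _) x -> mu [set x] = nu [set x]) -> U B mu = U B nu.
Proof.
move=> E; apply: eq_U => -[//|j]; rewrite /occupation.
suff -> : atoms B mu j.+1 = atoms B nu j.+1 by [].
by apply/seteqP; split=> x [Bx]; rewrite ?E// -?E// => xj; split=> //; rewrite ?E// -?E.
Qed.

Lemma U_add B mu nu :
  (forall x, (B : set _) x -> mu [set x] = 0 \/ nu [set x] = 0) ->
  U B (pm_add mu nu) = fpm_add (U B mu) (U B nu).
Proof.
move=> mn; apply: fpm_ext1 => j; rewrite fpm_addE !U_set1 -EFinD -natrD.
congr (_%:R%:E); case: j => // j; rewrite /occupation.
have zj : (0 : \bar R) <> j.+1%:R%:E by move=> [/esym/eqP]; rewrite pnatr_eq0.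
have -> : atoms B (pm_add mu nu) j.+1 = atoms B mu j.+1 `|` atoms B nu j.+1.
  apply/seteqP; split=> x.
    move=> [Bx]; rewrite pm_addE; case: (mn x Bx) => ->; rewrite ?add0e ?adde0 => E.
      by right; split.
    by left; split.
  move=> [|] [Bx E]; split=> //; rewrite pm_addE E; case: (mn x Bx) => E'.
  - by case: zj; rewrite -E' E.
  - by rewrite E' adde0.
  - by rewrite E' add0e.
  - by case: zj; rewrite -E' E.
have disj : atoms B mu j.+1 `&` atoms B nu j.+1 = set0.
  apply/seteqP; split=> // x [[Bx Em] [_ En]].
  by case: (mn x Bx); rewrite ?Em ?En => /esym/zj.
have f1 := atoms_finite B mu (ltn0Sn j); have f2 := atoms_finite B nu (ltn0Sn j).
by rewrite fset_setU// cardfsU -fset_setI// disj fset_set0 cardfs0 subn0.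
Qed.

Lemma measurable_U B : measurable_fun setT (U B).
Proof.
apply: measurable_fun_fpm => A.
apply: ge0_emeasurable_sum => [j mu _ _|j _]; first exact: measure_ge0.
rewrite /= /mscale /=; apply: emeasurable_funM; first exact: measurable_occupation.
exact: measurable_cst.
Qed.

End occupation_measure.

(** * Atomicity of point measures *)

Section atomicity.
Context {R : realType} {X : polishType R}.
Local Open Scope ereal_scope.
Implicit Types (mu nu : pointMeasure X).

(** A set of minimal positive mass is, up to null sets, contained in arbitrarily
    small balls, hence reduces to one point: a point measure is atomic. *)
Lemma pm_atom_bounded mu (A : boundedBorel X) : mu A != 0 ->
  exists2 x, (A : set _) x & mu [set x] != 0.
Proof.
move=> muA0.
pose p n := `[< exists C : set (borel X),
  [/\ measurable C, C `<=` A, mu C = n%:R%:E & (0 < n)%N] >].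
have exp : exists n, p n.
  have [n nE] := pm_integer mu A; exists n; apply/asboolP; exists A; split=> //.
    exact: bb_measurable.
  by rewrite lt0n; apply: contra muA0 => /eqP n0; rewrite nE n0.
case: (ex_minnP exp) => m /asboolP[C [mC CA muC m0]] minm.
have zero_or E : measurable E -> mu (C `&` E) != 0 -> mu (C `\` E) = 0.
  move=> mE CE0.
  have bCE : @bounded_subset R X (C `&` E).
    by apply: bounded_subsetS (bb_bounded A) => x [/CA].
  have [k kE] := pm_integer mu (BoundedBorel (measurableI _ _ mC mE) bCE).
  have mk : (m <= k)%N.
    apply: minm; apply/asboolP; exists (C `&` E); split=> //.
    - exact: measurableI.
    - by move=> x [/CA].
    - by rewrite lt0n; apply: contra CE0 => /eqP k0; rewrite [mu _]kE k0.
  have Cfin : mu C < +oo by rewrite muC ltry.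
  rewrite measureD// [X in X - _]muC [X in _ - X]kE; apply/eqP; rewrite eq_le; apply/andP; split.
    by rewrite -EFinB lee_fin subr_le0 ler_nat.
  have : mu (C `&` E) <= mu C.
    by apply: le_measure; [apply: mem_set; exact: measurableI|exact: mem_set|move=> x []].
  by rewrite muC [X in X <= _]kE -EFinB !lee_fin subr_ge0.
have [e eP] := @dense_sequence R X.
have small n : exists k, mu (C `&` (ball (e k) n.+1%:R^-1 : set (borel X))) != 0.
  apply: contrapT => /forallNP H.
  have : mu.-negligible (\bigcup_k (C `&` (ball (e k) n.+1%:R^-1 : set (borel X)))).
    apply: negligible_bigcup => k; apply/negligibleP.
      by apply: measurableI => //; exact: measurable_mball.
    by have /negP/negPn/eqP := H k.
  move=> neg; have /(negligibleP _ mC) muC0 : mu.-negligible C.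
    apply: negligibleS neg => x Cx.
    by have [|k xk] := eP n.+1%:R^-1%R x; [rewrite invr_gt0|exists k].
  by move: muC m0; rewrite muC0 => -[/esym/eqP]; rewrite pnatr_eq0 => /eqP ->.
have [k kP] := choice small.
pose I := C `&` \bigcap_n (ball (e (k n)) n.+1%:R^-1 : set (borel X)).
have mI : measurable I.
  apply: measurableI => //; apply: bigcap_measurable; first by exists 0%N.
  by move=> n _; exact: measurable_mball.
have CI0 : mu (C `\` I) = 0.
  apply/negligibleP; first exact: measurableD.
  apply: (@negligibleS _ _ _ _ (\bigcup_n (C `\` (ball (e (k n)) n.+1%:R^-1 : set (borel X))))).
    move=> x [Cx nI]; apply: contrapT => H; apply: nI; split=> // n _.
    by apply: contrapT => nb; apply: H; exists n.
  apply: negligible_bigcup => n; apply/negligibleP.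
    by apply: measurableD => //; exact: measurable_mball.
  by apply: zero_or => //; exact: measurable_mball.
have muI : mu I = m%:R%:E.
  rewrite -muC (measureDI mu mC mI) [X in X + _]CI0 add0e; congr (mu _).
  by apply/seteqP; split=> [x Ix|x []//]; split=> //; exact: Ix.1.
have [x Ix] : I !=set0.
  apply/set0P/eqP => I0; move: muI; rewrite I0 measure0 => -[/esym/eqP].
  by rewrite pnatr_eq0 => /eqP m00; rewrite m00 in m0.
exists x; first exact/CA/Ix.1.
have <- : I = [set x].
  apply/seteqP; split=> [y Iy|_ ->//].
  apply: contrapT => /eqP nyx.
  have d0 : (0 < mdist (y : X) x)%R by rewrite mdist_gt0.
  have [n nd] := small_inverse d0.
  have := ball_triangle (ball_sym (Iy.2 n Logic.I)) (Ix.2 n Logic.I).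
  rewrite ballEmdist /=.
  have <- : (2 * n.+1%:R^-1 = n.+1%:R^-1 + n.+1%:R^-1 :> R)%R.
    by rewrite mulr_natl mulr2n.
  by move=> /(lt_trans nd); rewrite ltxx.
by rewrite muI eqe pnatr_eq0 -lt0n.
Qed.

Lemma pm_atom mu (A : set (borel X)) : measurable A -> mu A != 0 ->
  exists2 x, A x & mu [set x] != 0.
Proof.
move=> mA muA; have [n An] : exists n, mu (bb_restr mA (bb_annulus X n)) != 0.
  apply: contrapT => /forallNP H; move/eqP: muA; apply.
  rewrite measure_annulus// eseries0// => n _ _.
  by have /negP/negPn/eqP := H n.
by have [x [Ax _] mux] := pm_atom_bounded An; exists x.
Qed.

Definition pm_support mu : set (borel X) := [set x | mu [set x] != 0].

Lemma mass_nat mu (x : borel X) : exists n : nat, mu [set x] = n%:R%:E.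
Proof. exact: (pm_integer mu (bb_point x)). Qed.

Lemma countable_pm_support mu : countable (pm_support mu).
Proof.
have -> : pm_support mu =
    \bigcup_n \bigcup_j atoms (bb_bigball X n) mu j.+1.
  apply/seteqP; split=> [x mux|x [n _ [j _ [_ xj]]]]; last first.
    by rewrite /pm_support /= xj eqe pnatr_eq0.
  have [n _ nx] : (\bigcup_n @bigball R X n) x by rewrite bigcup_bigball.
  exists n => //; have [[|j] xj] := mass_nat mu x.
    by move: mux; rewrite /pm_support /= xj eqxx.
  by exists j.
apply: bigcup_countable => // n _; apply: bigcup_countable => // j _.
exact/finite_set_countable/atoms_finite.
Qed.

Lemma measurable_countable (D : set (borel X)) : countable D -> measurable D.
Proof.
move=> cD; rewrite -[D]image_id -bigcup_imset1.
by apply: bigcup_countable_measurable => // x _; exact: measurable_point.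
Qed.

Lemma measurable_pm_support mu : measurable (pm_support mu).
Proof. by apply: measurable_countable; exact: countable_pm_support. Qed.

Lemma pm_supportC mu A : measurable A -> A `&` pm_support mu = set0 -> mu A = 0.
Proof.
move=> mA A0; apply/eqP/negPn/negP => /(pm_atom mA)[x Ax mux].
by have : (A `&` pm_support mu) x by []; rewrite A0.
Qed.

Lemma diffuse_countable (rho : locFinMeasure X) (D : set (borel X)) :
  diffuse rho -> countable D -> rho D = 0.
Proof.
move=> dr cD; apply/negligibleP; first exact: measurable_countable.
have [->|[e]] := pfcard_geP cD; first exact: negligible_set0.
apply: (@negligibleS _ _ _ _ (\bigcup_n [set e n])).
  by move=> x /(@surj _ _ _ _ e)[n _ <-]; exists n.
apply: negligible_bigcup => n; apply/negligibleP; first exact: measurable_point.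
exact: dr.
Qed.

End atomicity.

(** * Images of point measures *)

Lemma ge0_integral_mrestr d (T : measurableType d) (R : realType)
    (mu : {measure set T -> \bar R}) (D : set T) (mD : measurable D)
    (f : T -> \bar R) : measurable_fun setT f -> (forall x, (0 <= f x)%E) ->
  (\int[mrestr mu mD]_x f x = \int[mu]_(x in D) f x)%E.
Proof.
move=> mf f0; rewrite (@ge0_negligible_integral _ _ _ _ setT (~` D))//.
- rewrite setTD setCK; apply: eq_measure_integral => A mA AD.
  by rewrite /= /mrestr setIidl.
- exact: measurableC.
- by rewrite /= /mrestr setICl measure0.
Qed.

Section transport.
Context {R : realType} {X : polishType R}.
Local Open Scope ereal_scope.

(** The points of the domain are moved by the map, the others are deleted; both
    restrictions of point measures and relabellings of their atoms are of this
    form. *)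
Record transport := Transport {
  tr_dom : set (borel X) ;
  tr_map : borel X -> borel X ;
  tr_measurable_dom : measurable tr_dom ;
  tr_measurable_map : measurable_fun setT tr_map ;
  tr_bounded : forall B : boundedBorel X,
    @bounded_subset R X (tr_map @^-1` (B : set _) `&` tr_dom) }.

Variable tr : transport.

Definition tr_preimage (A : set (borel X)) := tr_map tr @^-1` A `&` tr_dom tr.

Lemma measurable_tr_preimage A : measurable A -> measurable (tr_preimage A).
Proof.
move=> mA; apply: measurableI; last exact: tr_measurable_dom.
by rewrite -[X in measurable X]setTI; exact: tr_measurable_map.
Qed.

Definition tr_bb (B : boundedBorel X) : boundedBorel X :=
  BoundedBorel (measurable_tr_preimage (bb_measurable B)) (tr_bounded tr B).

Section transport_measure.
Variable mu : {measure set (borel X) -> \bar R}.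

Definition tr_set_fun (A : set (borel X)) := mu (tr_preimage A).

Let tr0 : tr_set_fun set0 = 0.
Proof. by rewrite /tr_set_fun /tr_preimage preimage_set0 set0I measure0. Qed.

Let tr_ge0 A : 0 <= tr_set_fun A. Proof. exact: measure_ge0. Qed.

Let tr_sigma_additive : semi_sigma_additive tr_set_fun.
Proof.
move=> F mF tF mUF; rewrite /tr_set_fun /tr_preimage preimage_bigcup setI_bigcupl.
apply: measure_semi_sigma_additive.
- by move=> n; exact: measurable_tr_preimage.
- apply/trivIsetP => /= i j _ _ ij.
  rewrite setIACA -preimage_setI.
  by move/trivIsetP : tF => /(_ _ _ _ _ ij) ->//; rewrite preimage_set0 set0I.
- by rewrite -setI_bigcupl -preimage_bigcup; exact: measurable_tr_preimage.
Qed.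

HB.instance Definition _ :=
  isMeasure.Build _ _ _ tr_set_fun tr0 tr_ge0 tr_sigma_additive.

Definition tr_measure : {measure set (borel X) -> \bar R} := tr_set_fun.

Lemma ge0_integral_tr (f : borel X -> \bar R) :
  measurable_fun setT f -> (forall x, 0 <= f x) ->
  \int[tr_measure]_x f x = \int[mu]_x ((f \o tr_map tr) \_ (tr_dom tr)) x.
Proof.
move=> mf f0.
have mt := tr_measurable_map tr; have mD := tr_measurable_dom tr.
transitivity (\int[pushforward (mrestr mu mD) (tr_map tr)]_x f x).
  exact: eq_measure_integral.
rewrite ge0_integral_pushforward// preimage_setT ge0_integral_mrestr.
- by rewrite integral_mkcond.
- exact: measurableT_comp.
- by move=> x; exact: f0.
Qed.

End transport_measure.

Lemma lf_tr_finite (kap : locFinMeasure X) (B : boundedBorel X) :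
  tr_measure kap B < +oo.
Proof. exact: (lf_finite kap (tr_bb B)). Qed.

Definition lf_tr (kap : locFinMeasure X) : locFinMeasure X :=
  LocFinMeasure (lf_tr_finite kap).

Lemma pm_tr_integer (mu : pointMeasure X) (B : boundedBorel X) :
  exists n : nat, lf_tr mu B = n%:R%:E.
Proof. exact: (pm_integer mu (tr_bb B)). Qed.

Definition pm_tr (mu : pointMeasure X) : pointMeasure X :=
  PointMeasure (pm_tr_integer mu).

Lemma lf_trE kap A : lf_tr kap A = kap (tr_preimage A).
Proof. by []. Qed.

Lemma pm_trE mu A : pm_tr mu A = mu (tr_preimage A).
Proof. by []. Qed.

Lemma measurable_pm_tr : measurable_fun setT pm_tr.
Proof.
by apply: measurable_fun_pm => B; exact: (measurable_eval_bb (tr_bb B)).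
Qed.

Lemma pm_tr_add mu nu : pm_tr (pm_add mu nu) = pm_add (pm_tr mu) (pm_tr nu).
Proof. by apply: pm_ext => A; rewrite pm_addE !pm_trE pm_addE. Qed.

Lemma lf_tr_add kap kap' : lf_tr (lf_add kap kap') = lf_add (lf_tr kap) (lf_tr kap').
Proof. by apply: lf_ext => A; rewrite lf_addE !lf_trE lf_addE. Qed.

Lemma pm_tr_dirac x : tr_dom tr x -> pm_tr (pm_dirac x) = pm_dirac (tr_map tr x).
Proof.
move=> Dx; apply: pm_ext => A; rewrite pm_trE /= !diracE.
by congr (nat_of_bool _)%:R%:E; apply/idP/idP => /set_mem h; apply: mem_set => //; case: h.
Qed.

End transport.

Section restriction.
Context {R : realType} {X : polishType R}.
Variables (D : set (borel X)) (mD : measurable D).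

Lemma restriction_bounded (B : boundedBorel X) :
  @bounded_subset R X (idfun @^-1` (B : set _) `&` D).
Proof. by apply: bounded_subsetS (bb_bounded B) => x []. Qed.

Definition restriction : transport :=
  Transport mD (@measurable_id _ (borel X) setT) restriction_bounded.

End restriction.

Section law.
Context {d d'} {T : measurableType d} {T' : measurableType d'} {R : realType}.
Local Open Scope ereal_scope.

Section prob_of.
Variables (m : {measure set T -> \bar R}) (m1 : m setT = 1).

Definition prob_set_fun of m setT = 1 : set T -> \bar R := m.

Let p0 : prob_set_fun m1 set0 = 0. Proof. exact: measure0. Qed.

Let p_ge0 A : 0 <= prob_set_fun m1 A. Proof. exact: measure_ge0. Qed.

Let p_sigma_additive : semi_sigma_additive (prob_set_fun m1).
Proof. exact: measure_semi_sigma_additive. Qed.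

HB.instance Definition _ :=
  isMeasure.Build _ _ _ (prob_set_fun m1) p0 p_ge0 p_sigma_additive.

HB.instance Definition _ :=
  Measure_isProbability.Build _ _ _ (prob_set_fun m1) m1.

Definition prob_of : probability T R := prob_set_fun m1.

End prob_of.

Variables (P : probability T R) (f : T -> T') (mf : measurable_fun setT f).

Definition law_mfun : {mfun T >-> T'} :=
  MeasurableFun.Pack (MeasurableFun.Class (isMeasurableFun.Build _ _ _ _ f mf)).

Definition law : probability T' R := distribution P law_mfun.

Lemma ge0_integral_law (h : T' -> \bar R) :
  measurable_fun setT h -> (forall y, 0 <= h y) ->
  \int[law]_y h y = \int[P]_x h (f x).
Proof. by move=> mh h0; rewrite ge0_integral_distribution. Qed.

End law.

(** * Stability of the Polya sum equation *)

Section polya_equation.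
Context {R : realType} {X : polishType R}.
Local Open Scope ereal_scope.
Implicit Types (kap : locFinMeasure X) (P : probability (pointMeasure X) R).

Section measurability.
Context {d} {T : measurableType d} (f g : T -> pointMeasure X).
Hypotheses (mf : measurable_fun setT f) (mg : measurable_fun setT g).
Variable h : borel X * pointMeasure X -> \bar R.
Hypotheses (mh : measurable_fun setT h) (h0 : forall u, 0 <= h u).

Lemma measurable_campbell : measurable_fun setT (fun t => \int[g t]_x h (x, f t)).
Proof.
rewrite (_ : (fun t => _) = fun t => \int[lf_add lf_zero (g t)]_x h (x, f t)).
  apply: (measurable_fun_integral_pm lf_zero mg (f := fun u => h (u.2, f u.1))) => //.
  apply: (measurableT_comp mh); apply: measurable_fun_pair.
    exact: measurable_snd.
  exact: (measurableT_comp mf).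
by apply/funext => t; rewrite lf_add0.
Qed.

Lemma measurable_reduced_campbell kap : measurable_fun setT
  (fun t => \int[lf_add kap (g t)]_x h (x, pm_add (f t) (pm_dirac x))).
Proof.
apply: (measurable_fun_integral_pm kap mg
  (f := fun u => h (u.2, pm_add (f u.1) (pm_dirac u.2)))) => //.
apply: (measurableT_comp mh); apply: measurable_fun_pair.
  exact: measurable_snd.
apply: measurable_pm_add; first exact: (measurableT_comp mf).
by apply: measurable_pm_dirac; exact: measurable_snd.
Qed.

End measurability.

Section sections.
Variable h : borel X * pointMeasure X -> \bar R.
Hypothesis mh : measurable_fun setT h.

Lemma measurable_campbell_section nu : measurable_fun setT (fun x => h (x, nu)).
Proof. by apply: measurable_fun_pair1; exact: mh. Qed.

Lemma measurable_reduced_section nu :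
  measurable_fun setT (fun x => h (x, pm_add nu (pm_dirac x))).
Proof.
apply: (measurableT_comp mh); apply: measurable_fun_pair; first exact: measurable_id.
apply: measurable_pm_add; first exact: measurable_cst.
by apply: measurable_pm_dirac; exact: measurable_id.
Qed.

End sections.

Lemma polya_ext_intensity z kap kap' (P : set (pointMeasure X) -> \bar R) :
  (forall A, measurable A -> kap A = kap' A) ->
  polya_sum_equation z kap P -> polya_sum_equation z kap' P.
Proof.
move=> kk' HP h mh h0; rewrite (HP h mh h0); congr (integral P setT _).
apply/funext => mu; congr (_ * _); apply: eq_measure_integral => A mA _.
by rewrite !lf_addE kk'.
Qed.

(** In the equation of the transported law every integral runs over transported
    measures; a test function h is therefore pulled back to the function that
    is h at the image point and image measure on the domain, and zero off it. *)
Lemma polya_transport tr z kap P : (0 <= z)%R ->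
  polya_sum_equation z kap P ->
  polya_sum_equation z (lf_tr tr kap) (law P (measurable_pm_tr tr)).
Proof.
move=> z0 HP h mh h0.
pose h' (u : borel X * pointMeasure X) :=
  (\1_(tr_dom tr) u.1)%:E * h (tr_map tr u.1, pm_tr tr u.2).
have mh' : measurable_fun setT h'.
  apply: emeasurable_funM.
    apply/measurable_EFinP.
    exact: (measurableT_comp (measurable_indic (tr_measurable_dom tr)) measurable_fst).
  apply: (measurableT_comp mh); apply: measurable_fun_pair.
    exact: (measurableT_comp (tr_measurable_map tr) measurable_fst).
  exact: (measurableT_comp (measurable_pm_tr tr) measurable_snd).
have h'0 u : 0 <= h' u by apply: mule_ge0 => //; rewrite lee_fin.
have patchE (f : borel X -> \bar R) :
    (f \o tr_map tr) \_ (tr_dom tr) = fun x => (\1_(tr_dom tr) x)%:E * f (tr_map tr x).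
  by apply/funext => x; rewrite patchE indicE; case: ifPn; rewrite ?mul1e ?mul0e.
rewrite ge0_integral_law; last 2 first.
- by apply: measurable_campbell => //; exact: measurable_id.
- by move=> mu; exact: integral_ge0.
transitivity (\int[P]_mu \int[mu]_x h' (x, mu)).
  apply: eq_integral => mu _; rewrite ge0_integral_tr//.
    by rewrite (patchE (fun x => h (x, pm_tr tr mu))).
  exact: measurable_campbell_section.
rewrite (HP h' mh' h'0) ge0_integral_law; last 2 first.
- by apply: measurable_funeM; apply: measurable_reduced_campbell => //; exact: measurable_id.
- by move=> mu; apply: mule_ge0; rewrite ?lee_fin//; exact: integral_ge0.
apply: eq_integral => mu _; congr (_ * _).
rewrite -(lf_tr_add tr kap mu) ge0_integral_tr//; last exact: measurable_reduced_section.
rewrite (patchE (fun x => h (x, pm_add (pm_tr tr mu) (pm_dirac x)))).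
apply: eq_integral => x _; rewrite /h' /= indicE.
have [/set_mem xD|] := boolP (x \in tr_dom tr); last by rewrite !mul0e.
by rewrite pm_tr_add pm_tr_dirac.
Qed.

Lemma measurable_pm_convolution : measurable_fun setT
  (fun m : pointMeasure X * pointMeasure X => pm_add m.1 m.2).
Proof. exact: measurable_pm_add measurable_fst measurable_snd. Qed.

(** The integral against a sum splits, and each summand is treated by its own
    equation while the other one is frozen. *)
Lemma polya_convolution z kap1 kap2 P1 P2 : (0 <= z)%R ->
  polya_sum_equation z kap1 P1 -> polya_sum_equation z kap2 P2 ->
  polya_sum_equation z (lf_add kap1 kap2)
    (law (P1 \x P2)%E measurable_pm_convolution).
Proof.
move=> z0 HP1 HP2 h mh h0.
pose add (m : pointMeasure X * pointMeasure X) := pm_add m.1 m.2.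
have madd : measurable_fun setT add := measurable_pm_convolution.
have m1 := @measurable_fst _ _ (pointMeasure X) (pointMeasure X).
have m2 := @measurable_snd _ _ (pointMeasure X) (pointMeasure X).
have msh nu : measurable_fun setT
    (fun u : borel X * pointMeasure X => h (u.1, pm_add u.2 nu)).
  apply: (measurableT_comp mh); apply: measurable_fun_pair; first exact: measurable_fst.
  by apply: measurable_pm_add; [exact: measurable_snd|exact: measurable_cst].
have msh' nu : measurable_fun setT
    (fun u : borel X * pointMeasure X => h (u.1, pm_add nu u.2)).
  apply: (measurableT_comp mh); apply: measurable_fun_pair; first exact: measurable_fst.
  by apply: measurable_pm_add; [exact: measurable_cst|exact: measurable_snd].
pose A1 (m : pointMeasure X * pointMeasure X) := \int[m.1]_x h (x, add m).
pose A2 (m : pointMeasure X * pointMeasure X) := \int[m.2]_x h (x, add m).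
pose B1 (m : pointMeasure X * pointMeasure X) := z%:E * \int[lf_add kap1 m.1]_x h (x, pm_add (add m) (pm_dirac x)).
pose B2 (m : pointMeasure X * pointMeasure X) := z%:E * \int[lf_add kap2 m.2]_x h (x, pm_add (add m) (pm_dirac x)).
have mA1 : measurable_fun setT A1 by exact: (measurable_campbell madd m1 mh h0).
have mA2 : measurable_fun setT A2 by exact: (measurable_campbell madd m2 mh h0).
have mB1 : measurable_fun setT B1.
  by apply: measurable_funeM; exact: (measurable_reduced_campbell madd m1 mh h0).
have mB2 : measurable_fun setT B2.
  by apply: measurable_funeM; exact: (measurable_reduced_campbell madd m2 mh h0).
have A10 m : 0 <= A1 m by exact: integral_ge0.
have A20 m : 0 <= A2 m by exact: integral_ge0.
have z0' : 0 <= z%:E by rewrite lee_fin.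
have B10 m : 0 <= B1 m by apply: mule_ge0 => //; exact: integral_ge0.
have B20 m : 0 <= B2 m by apply: mule_ge0 => //; exact: integral_ge0.
have E1 : \int[(P1 \x P2)%E]_m A1 m = \int[(P1 \x P2)%E]_m B1 m.
  rewrite (fubini_tonelli2 _ mA1 A10) (fubini_tonelli2 _ mB1 B10).
  apply: eq_integral => nu _; rewrite /fubini_G /A1 /B1 /add /=.
  rewrite (HP1 (fun u => h (u.1, pm_add u.2 nu)) (msh nu) (fun u => h0 _)).
  apply: eq_integral => mu _; congr (_ * _); apply: eq_integral => x _ /=.
  by congr (h (_, _)); apply: pm_ext => A; rewrite !pm_addE addeAC.
have E2 : \int[(P1 \x P2)%E]_m A2 m = \int[(P1 \x P2)%E]_m B2 m.
  rewrite (fubini_tonelli1 _ mA2 A20) (fubini_tonelli1 _ mB2 B20).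
  apply: eq_integral => nu _; rewrite /fubini_F /A2 /B2 /add /=.
  rewrite (HP2 (fun u => h (u.1, pm_add nu u.2)) (msh' nu) (fun u => h0 _)).
  apply: eq_integral => mu _; congr (_ * _); apply: eq_integral => x _ /=.
  by congr (h (_, _)); apply: pm_ext => A; rewrite !pm_addE addeA.
rewrite ge0_integral_law; last 2 first.
- exact: (measurable_campbell (@measurable_id _ _ setT) (@measurable_id _ _ setT) mh h0).
- by move=> mu; exact: integral_ge0.
rewrite ge0_integral_law; last 2 first.
- apply: measurable_funeM.
  exact: (measurable_reduced_campbell (@measurable_id _ _ setT) (@measurable_id _ _ setT) mh h0).
- by move=> mu; apply: mule_ge0 => //; exact: integral_ge0.
transitivity (\int[(P1 \x P2)%E]_m (A1 m + A2 m)).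
  apply: eq_integral => m _; rewrite -ge0_integral_measure_add; [by []|by []|by []|].
  exact: (measurable_campbell_section mh).
have D1 := @ge0_integralD _ _ _ (P1 \x P2)%E setT measurableT A1 A2
  (fun m _ => A10 m) mA1 (fun m _ => A20 m) mA2.
have D2 := @ge0_integralD _ _ _ (P1 \x P2)%E setT measurableT B1 B2
  (fun m _ => B10 m) mB1 (fun m _ => B20 m) mB2.
rewrite [LHS]D1 E1 E2 -[LHS]D2.
apply: eq_integral => m _; rewrite /B1 /B2 -ge0_muleDr; [|exact: integral_ge0..].
congr (_ * _); rewrite -ge0_integral_measure_add;
  [|by []|by []|exact: (measurable_reduced_section mh)].
apply: eq_measure_integral => A mA _.
rewrite [LHS]measure_addE [RHS]lf_addE [X in X + _]lf_addE [X in _ + X]lf_addE.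
by rewrite [X in _ = _ + X]pm_addE lf_addE addeACA.
Qed.

End polya_equation.

(** * Null sets, restriction and independence *)

Lemma eq_measure_offnull d (T : measurableType d) (R : realType)
    (Q : {measure set T -> \bar R}) (N A B : set T) :
  measurable N -> Q N = 0%E -> measurable A -> measurable B ->
  A `\` N = B `\` N -> Q A = Q B.
Proof.
move=> mN QN mA mB AB.
suff H C : measurable C -> Q C = Q (C `\` N) by rewrite (H A)// (H B)// AB.
move=> mC; rewrite (measureDI Q mC mN) [X in (_ + X)%E](_ : _ = 0%E) ?adde0//.
apply/negligibleP; first exact: measurableI.
by apply: (@negligibleS _ _ _ _ N) => [x []//|]; exact/negligibleP.
Qed.

Section polya_uniqueness.
Context {R : realType} {X : polishType R}.
Local Open Scope ereal_scope.
Implicit Types (kap : locFinMeasure X) (P Q : probability (pointMeasure X) R).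

Lemma measurable_charges (D : set (borel X)) : measurable D ->
  measurable [set m : pointMeasure X | m D != 0].
Proof.
move=> mD.
rewrite [X in measurable X](_ : _ = ~` ((fun m : pointMeasure X => m D) @^-1` [set 0])).
  apply: measurableC; rewrite -[X in measurable X]setTI.
  exact: (measurable_eval mD measurableT (emeasurable_set1 0)).
by apply/seteqP; split=> m /= /eqP.
Qed.

Lemma restriction_id (D : set (borel X)) (mD : measurable D) (m : pointMeasure X) :
  m (~` D) = 0 -> forall A, measurable A -> pm_tr (restriction mD) m A = m A.
Proof.
move=> mD0 A mA; rewrite pm_trE /tr_preimage /= (measureDI m mA mD).
rewrite [X in _ = X + _](_ : _ = 0) ?add0e//.
apply/eqP; rewrite eq_le measure_ge0 andbT -mD0; apply: le_measure.
- by apply: mem_set; exact: measurableD.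
- by apply: mem_set; exact: measurableC.
- by move=> x [].
Qed.

Section null_sets.
Variables (z : R) (kap : locFinMeasure X) (Q : probability (pointMeasure X) R).
Hypotheses (z0 : (0 <= z)%R) (HQ : polya_sum_equation z kap Q).

Let S (E : boundedBorel X) k := [set m : pointMeasure X | m E = k%:R%:E].

Let mS E k : measurable (S E k).
Proof.
rewrite -[X in measurable X]setTI.
exact: (measurable_eval_bb E measurableT (emeasurable_set1 k%:R%:E)).
Qed.

(** The test function is the indicator of x in E and mu E = k + 1: adding a point
    of E turns mu E = k into mu E = k + 1, and only mu contributes to kap + mu
    on E. *)
Lemma polya_count_recursion (E : boundedBorel X) k : kap E = 0 ->
  k.+1%:R%:E * Q [set m : pointMeasure X | m E = k.+1%:R%:E] =
  z%:E * (k%:R%:E * Q [set m : pointMeasure X | m E = k%:R%:E]).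
Proof.
move=> kE.
pose h (u : borel X * pointMeasure X) : \bar R :=
  (\1_((E : set _) `*` S E k.+1) u)%:E.
have mh : measurable_fun setT h.
  apply/measurable_EFinP; apply: measurable_indic.
  by apply: measurableX => //; exact: bb_measurable.
have h0 u : 0 <= h u by rewrite lee_fin.
have indicE_int (m : {measure set (borel X) -> \bar R}) :
    \int[m]_x (\1_(E : set (borel X)) x)%:E = m E.
  by rewrite integral_indic ?setIT//; exact: bb_measurable.
have L (m : pointMeasure X) : \int[m]_x h (x, m) = k.+1%:R%:E * (\1_(S E k.+1) m)%:E.
  have [mS1|mS1] := pselect (S E k.+1 m).
    rewrite [in RHS]indicE mem_set// mule1 -[RHS]mS1 -indicE_int.
    apply: eq_integral => x _; congr (_%:E); apply: eq_indic.
    by split=> [[]|].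
  rewrite [in RHS]indicE memNset// mule0; apply: integral0_eq => x _.
  by rewrite /h indicE memNset// => -[].
have Rk (m : pointMeasure X) : \int[lf_add kap m]_x h (x, pm_add m (pm_dirac x)) =
    k%:R%:E * (\1_(S E k) m)%:E.
  have dirac_shift x : (E : set _) x ->
      (pm_add m (pm_dirac x) E = k.+1%:R%:E <-> m E = k%:R%:E).
    move=> Ex; rewrite pm_addE [X in _ + X]diracE mem_set//.
    have [n ->] := pm_integer m E; rewrite -EFinD natr1.
    by split=> -[] /eqP; rewrite eqr_nat => /eqP; [case=> ->|move=> ->].
  have [mS1|mS1] := pselect (S E k m).
    rewrite [in RHS]indicE mem_set// mule1.
    transitivity (lf_add kap m E); last by rewrite lf_addE [X in X + _]kE add0e.
    rewrite -indicE_int; apply: eq_integral => x _; congr (_%:E); apply: eq_indic.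
    by split=> [[]//|/= Ex]; split=> //; exact/dirac_shift.
  rewrite [in RHS]indicE memNset// mule0; apply: integral0_eq => x _.
  by rewrite /h indicE memNset// => -[/= Ex /dirac_shift] /(_ Ex).
have ZI (c j : nat) : \int[Q]_m (c%:R%:E * (\1_(S E j) m)%:E) = c%:R%:E * Q (S E j).
  rewrite ge0_integralZl_EFin//.
  - by rewrite integral_indic ?setIT//.
  - by apply/measurable_EFinP; exact: measurable_indic.
have := HQ mh h0; under eq_integral do rewrite L.
under [in RHS]eq_integral do rewrite Rk.
rewrite ZI => ->; rewrite -ZI ge0_integralZl_EFin//.
- by apply: measurable_funeM; apply/measurable_EFinP; exact: measurable_indic.
Qed.

(** The recursion gives probability 0 to mu E = 1, then to all positive counts. *)
Lemma polya_null (D : set (borel X)) : measurable D -> kap D = 0 ->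
  Q [set m : pointMeasure X | m D != 0] = 0.
Proof.
move=> mD kD.
have S0 n k : Q (S (bb_restr mD (bb_annulus X n)) k.+1) = 0.
  have kE : kap (bb_restr mD (bb_annulus X n)) = 0.
    apply/eqP; rewrite eq_le measure_ge0 andbT -kD; apply: le_measure.
    - by apply: mem_set; exact: bb_measurable.
    - exact: mem_set.
    - by move=> x [].
  elim: k => [|k IH]; have := polya_count_recursion _ kE.
    by move=> /(_ 0%N); rewrite mul0e mule0 mul1e.
  move=> /(_ k.+1); rewrite [Q [set m | _ = k.+1%:R%:E]]IH !mule0 => /eqP.
  by rewrite mule_eq0 eqe pnatr_eq0 /= => /eqP.
have mN := measurable_charges mD.
apply/(negligibleP _ mN).
apply: (@negligibleS _ _ _ _
  (\bigcup_n \bigcup_k S (bb_restr mD (bb_annulus X n)) k.+1)); last first.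
  apply: negligible_bigcup => n; apply: negligible_bigcup => k.
  by apply/negligibleP; [exact: mS|exact: S0].
move=> m /= mD0; apply: contrapT => H; move/eqP: mD0; apply.
rewrite measure_annulus// eseries0// => n _ _.
have [[|k] nk] := pm_integer m (bb_restr mD (bb_annulus X n)); first exact: nk.
by exfalso; apply: H; exists n => //; exists k.
Qed.

End null_sets.

Lemma restriction_intensity kap (D : set (borel X)) (mD : measurable D) A :
  measurable A ->
  lf_add (lf_tr (restriction mD) kap)
         (lf_tr (restriction (measurableC mD)) kap) A = kap A.
Proof.
move=> mA; rewrite lf_addE !lf_trE addeC /tr_preimage /= -setDE.
by rewrite -(measureDI kap mA mD).
Qed.

(** A competitor Q for the restricted intensity, convolved with the law
    restricted to the complement, solves the unrestricted equation; uniqueness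
    there identifies Q, which by polya_null is carried by the measures that do
    not charge the complement of D. *)
Lemma is_polya_sum_restriction z kap P (D : set (borel X)) (mD : measurable D) :
  (0 <= z)%R -> is_polya_sum z kap P ->
  is_polya_sum z (lf_tr (restriction mD) kap)
    (law P (measurable_pm_tr (restriction mD))).
Proof.
move=> z0 [P1 HP uP]; set r := restriction mD.
set rC := restriction (measurableC mD).
split; [exact: probability_setT|exact: polya_transport|move=> Q HQ A mA].
pose Q' := law (Q \x law P (measurable_pm_tr rC))%E (@measurable_pm_convolution R X).
have HQ' : polya_sum_equation z kap Q'.
  apply: (@polya_ext_intensity _ _ z (lf_add (lf_tr r kap) (lf_tr rC kap))); last first.
    by apply: polya_convolution => //; exact: polya_transport.
  exact: restriction_intensity.
have mS : measurable (pm_tr r @^-1` A).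
  by rewrite -[X in measurable X]setTI; exact: measurable_pm_tr.
have Q'P := uP Q' HQ' _ mS.
rewrite [RHS]/= -[RHS]/(P (pm_tr r @^-1` A)) -Q'P.
have rrC m1 m2 : pm_tr r (pm_add m1 (pm_tr rC m2)) = pm_tr r m1.
  apply: pm_ext => C; rewrite pm_tr_add pm_addE !pm_trE.
  rewrite [X in _ + X](_ : _ = 0) ?adde0//.
  by rewrite -[RHS](measure0 m2); congr (m2 _); apply/seteqP; split=> x // [[]].
transitivity (Q (pm_tr r @^-1` A)).
  apply: (@eq_measure_offnull _ _ _ Q [set m | m (~` D) != 0]) => //.
  - by apply: measurable_charges; exact: measurableC.
  - apply: (polya_null z0 HQ); first exact: measurableC.
    by rewrite lf_trE /tr_preimage /= setICl measure0.
  - apply/seteqP; split=> m [Am /negP/negPn/eqP m0]; split=> //; try by rewrite /= m0 eqxx.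
      apply: (@pm_indistinguishable _ _ m (pm_tr r m) A _ mA Am) => B.
      by rewrite restriction_id//; exact: bb_measurable.
    apply: (@pm_indistinguishable _ _ (pm_tr r m) m A _ mA Am) => B.
    by rewrite restriction_id//; exact: bb_measurable.
rewrite -[in LHS](setIT (pm_tr r @^-1` A)) -integral_indic//.
apply: eq_integral => m1 _; rewrite /=.
rewrite (_ : distribution _ _ _ = P [set m | A (pm_tr r m1)]); last first.
  congr (P _); apply/seteqP; split=> m /=; rewrite /xsection /=.
    by move=> /set_mem /=; rewrite rrC.
  by move=> Am; apply: mem_set; rewrite /= rrC.
have [Am|Am] := pselect (A (pm_tr r m1)).
  rewrite indicE mem_set// (_ : [set _ | _] = setT) ?probability_setT//.
  by apply/seteqP; split.
rewrite indicE memNset// (_ : [set _ | _] = set0) ?measure0//.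
by apply/seteqP; split.
Qed.

(** Uniqueness makes the restrictions to D and to its complement independent:
    the convolution of their laws solves the equation that characterizes P. *)
Lemma is_polya_sum_split z kap P (D : set (borel X)) (mD : measurable D) A :
  (0 <= z)%R -> is_polya_sum z kap P -> measurable A ->
  P A = law (law P (measurable_pm_tr (restriction mD)) \x
             law P (measurable_pm_tr (restriction (measurableC mD))))%E
          (@measurable_pm_convolution R X) A.
Proof.
move=> z0 [P1 HP uP] mA; apply/esym/uP => //.
apply: (@polya_ext_intensity _ _ z (lf_add (lf_tr (restriction mD) kap)
  (lf_tr (restriction (measurableC mD)) kap))); last first.
  by apply: polya_convolution => //; exact: polya_transport.
exact: restriction_intensity.
Qed.

End polya_uniqueness.

(** * Relabelling of atoms *)

Section relabelling.
Context {R : realType} {X : polishType R}.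
Local Open Scope ereal_scope.
Variables (B : boundedBorel X).
Implicit Types nu mu : pointMeasure X.

Definition pm_support_in nu : set (borel X) := pm_support nu `&` (B : set _).

Lemma countable_pm_support_in nu : countable (pm_support_in nu).
Proof.
by apply: sub_countable (countable_pm_support nu); apply: subset_card_le => x [].
Qed.

Lemma measurable_pm_support_in nu : measurable (pm_support_in nu).
Proof. by apply: measurable_countable; exact: countable_pm_support_in. Qed.

Record relabelling nu nu' (phi : borel X -> borel X) : Prop := Relabelling {
  rl_measurable : measurable_fun setT phi ;
  rl_bij : set_bij (pm_support_in nu) (pm_support_in nu') phi ;
  rl_mass : forall x, pm_support_in nu x -> nu' [set phi x] = nu [set x] }.

(** Equal occupation numbers allow matching the atoms of the two measures in B,
    multiplicity by multiplicity. *)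
Lemma relabelling_exists nu nu' : U B nu = U B nu' ->
  exists phi, relabelling nu nu' phi.
Proof.
move=> Unn'.
(* The class of multiplicity 0 is not finite, hence the shift of indices. *)
have ex j : exists f : borel X -> borel X,
    set_bij (atoms B nu j.+1) (atoms B nu' j.+1) f.
  apply/card_set_bijP/fcard_eq; [exact: atoms_finite|exact: atoms_finite|].
  exact: (U_inj_occupation j.+1 Unn').
have [f fP] := choice ex.
have [m mP] := choice (mass_nat nu).
(* A constant value off the countable set of atoms makes phi measurable. *)
pose phi x := if x \in pm_support_in nu then f (m x).-1 x else point.
have atomsE x : pm_support_in nu x -> atoms B nu (m x).-1.+1 x.
  move=> [nx Bx]; split; first exact: Bx.
  have mx : (0 < m x)%N.
    by move: nx; rewrite /pm_support /= mP eqe pnatr_eq0 lt0n.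
  by rewrite (prednK mx) mP.
have phiE x : pm_support_in nu x -> phi x = f (m x).-1 x.
  by move=> /mem_set xD; rewrite /phi xD.
have phi_atoms x : pm_support_in nu x -> atoms B nu' (m x).-1.+1 (phi x).
  move=> xD; rewrite (phiE x xD); case: (fP (m x).-1) => fm _ _.
  exact: fm (atomsE x xD).
have support_atoms mu j x : atoms B mu j.+1 x -> pm_support_in mu x.
  move=> [Bx mx]; split; last exact: Bx.
  by rewrite /pm_support /= mx eqe pnatr_eq0.
have mass x : pm_support_in nu x -> nu' [set phi x] = nu [set x].
  by move=> xD; have [_ ->] := phi_atoms x xD; have [_ ->] := atomsE x xD.
exists phi; split; [|split|exact: mass].
- move=> _ A mA; rewrite setTI.
  have -> : phi @^-1` A = (phi @^-1` A `&` pm_support_in nu) `|`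
      ([set x | A point] `&` ~` pm_support_in nu).
    apply/seteqP; split=> x /=; rewrite /phi.
      move=> Ax; have [xD|xD] := pselect (pm_support_in nu x); first by left.
      by right; split=> //; move: Ax; rewrite memNset.
    by case=> [[]//|[Ap xD]]; rewrite memNset.
  apply: measurableU.
    apply: measurable_countable.
    apply: sub_countable (countable_pm_support_in nu).
    by apply: subset_card_le => x [].
  apply: measurableI; last by apply: measurableC; exact: measurable_pm_support_in.
  have [Ap|Ap] := pselect (A point).
    rewrite (_ : [set _ | _] = setT); first exact: measurableT.
    by apply/seteqP; split=> [x _|x _]; [exact: Logic.I|exact: Ap].
  rewrite (_ : [set _ | _] = set0); first exact: measurable0.
  by apply/seteqP; split=> [x /Ap []|x []].
- by move=> x xD; exact: support_atoms (phi_atoms x xD).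
- move=> x y /set_mem xD /set_mem yD xy.
  have mxy : m x = m y.
    have := mass x xD; rewrite xy (mass y yD) !mP => -[] /eqP.
    by rewrite eqr_nat => /eqP ->.
  have [_ inj _] := fP (m x).-1.
  apply: inj; [exact/mem_set/atomsE|rewrite mxy; exact/mem_set/atomsE|].
  by rewrite -(phiE x xD) xy (phiE y yD) mxy.
- move=> y [ny By]; have [[|j] yj] := mass_nat nu' y.
    by move: ny; rewrite /pm_support /= yj eqxx.
  have [_ _ surj] := fP j; have [x xj xy] := surj y (conj By yj).
  have xD := support_atoms _ _ _ xj; exists x; first exact: xD.
  rewrite (phiE x xD) -xy; congr (f _ x); case: xj => _; rewrite mP => -[] /eqP.
  by rewrite eqr_nat => /eqP ->.
Qed.

Lemma finite_pm_support_in nu : finite_set (pm_support_in nu).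
Proof.
have [N NE] := pm_integer nu B.
apply: (@sub_finite_set _ _ (\bigcup_(j < N) atoms B nu j.+1)); last first.
  by apply: bigcup_finite => // j _; exact: atoms_finite.
move=> x [nx Bx]; have [[|j] xj] := mass_nat nu x.
  by move: nx; rewrite /pm_support /= xj eqxx.
exists j; last by split.
have : nu [set x] <= nu B.
  apply: le_measure; last by move=> _ ->.
    by apply: mem_set; exact: measurable_point.
  by apply: mem_set; exact: bb_measurable.
by rewrite xj NE lee_fin ler_nat.
Qed.

End relabelling.

Section masses.
Context {R : realType} {X : polishType R}.
Local Open Scope ereal_scope.
Implicit Types nu mu : pointMeasure X.

(** By atomicity a bounded set carries the sum of the masses of its points. *)
Lemma pm_eq_mass mu nu : (forall x, mu [set x] = nu [set x]) ->
  forall A, measurable A -> mu A = nu A.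
Proof.
move=> mn A mA; rewrite !measure_annulus//; apply: eq_eseriesr => n _.
pose Bn := bb_restr mA (bb_annulus X n).
have sE : pm_support_in Bn mu = pm_support_in Bn nu.
  by apply/seteqP; split=> x [sx Bx]; split=> //; move: sx; rewrite /pm_support /= mn.
have H m : pm_support_in Bn m = pm_support_in Bn mu ->
    m Bn = \sum_(x \in pm_support_in Bn mu) m [set x].
  move=> <-; rewrite -pm_finite_sum; last exact: finite_pm_support_in.
  have mB := bb_measurable Bn; have mS := measurable_pm_support m.
  rewrite (measureDI m mB mS) [X in X + _](_ : _ = 0); first by rewrite add0e setIC.
  apply: pm_supportC; first exact: measurableD.
  by rewrite setDE -setIA setICl setI0.
by rewrite [LHS]H// [RHS]H//; apply: eq_fsbigr => x _.
Qed.

Lemma mass0 mu (A : set (borel X)) : A = set0 -> mu A = 0.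
Proof. by move=> ->; exact: measure0. Qed.

Lemma restriction_mass (D : set (borel X)) (mD : measurable D) mu x :
  D x -> pm_tr (restriction mD) mu [set x] = mu [set x].
Proof.
move=> Dx; rewrite pm_trE; congr (mu _).
by apply/seteqP; split=> y [] // -> ; split.
Qed.

Lemma restriction_mass0 (D : set (borel X)) (mD : measurable D) mu x :
  ~ D x -> pm_tr (restriction mD) mu [set x] = 0.
Proof.
by move=> Dx; rewrite pm_trE; apply: mass0; apply/seteqP; split=> // y [/= -> /Dx].
Qed.

Lemma off_support nu x : ~ pm_support nu x -> nu [set x] = 0.
Proof. by move=> /negP/negPn/eqP. Qed.

End masses.

Section relabelling_transport.
Context {R : realType} {X : polishType R}.
Local Open Scope ereal_scope.
Variables (B : boundedBorel X) (nu nu' : pointMeasure X) (phi : borel X -> borel X).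
Hypothesis rl : relabelling B nu nu' phi.
Implicit Types m : pointMeasure X.

Lemma relabel_bounded (C : boundedBorel X) :
  @bounded_subset R X (phi @^-1` (C : set _) `&` pm_support_in B nu).
Proof. by apply: bounded_subsetS (bb_bounded B) => x [_ []]. Qed.

Definition relabel : transport :=
  Transport (measurable_pm_support_in B nu) (rl_measurable rl) relabel_bounded.

Let D2 := pm_support_in B nu'.
Let r2 := restriction (measurable_pm_support_in B nu').

Lemma relabel_preimage x : pm_support_in B nu x ->
  tr_preimage relabel [set phi x] = [set x].
Proof.
move=> xD; apply/seteqP; split=> [y [/= xy yD]|_ ->]; last by split.
by have [_ inj _] := rl_bij rl; apply: inj => //; exact: mem_set.
Qed.

Lemma relabel_mass m x : pm_support_in B nu x ->
  pm_tr relabel m [set phi x] = m [set x].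
Proof. by move=> xD; rewrite pm_trE relabel_preimage. Qed.

Lemma relabel_mass0 m y : ~ D2 y -> pm_tr relabel m [set y] = 0.
Proof.
move=> yD; rewrite pm_trE; apply: mass0; apply/seteqP; split=> // x [/= xy xD].
by apply: yD; rewrite -xy; have [f _ _] := rl_bij rl; exact: f.
Qed.

Lemma relabel_source A : measurable A -> pm_tr relabel nu A = pm_tr r2 nu' A.
Proof.
move: A; apply: pm_eq_mass => y.
have [yD|yD] := pselect (D2 y); last by rewrite relabel_mass0// restriction_mass0.
rewrite restriction_mass//; have [_ _ surj] := rl_bij rl.
by have [x xD <-] := surj y yD; rewrite relabel_mass// (rl_mass rl).
Qed.

(** Moving the atoms changes neither their number nor their multiplicities. *)
Lemma U_relabel m :
  U B (pm_add (pm_tr (restriction (measurable_pm_support nu)) m) nu) =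
  U B (pm_add (pm_tr relabel m) (pm_tr relabel nu)).
Proof.
set L := pm_add _ nu; set L' := pm_add (pm_tr relabel m) _.
have LE x : pm_support_in B nu x -> L' [set phi x] = L [set x].
  move=> xD; rewrite [LHS]pm_addE [RHS]pm_addE !relabel_mass//.
  by rewrite restriction_mass//; case: xD.
apply: eq_U => -[//|j]; apply/fcard_eq; try exact: atoms_finite.
apply/card_set_bijP; exists phi.
have zj : (0 : \bar R) <> j.+1%:R%:E by move=> [/esym/eqP]; rewrite pnatr_eq0.
have atomsD x : atoms B L j.+1 x -> pm_support_in B nu x.
  move=> [Bx Lx]; split=> //; apply: contrapT => xD; apply: zj; rewrite -Lx.
  by rewrite [RHS]pm_addE restriction_mass0// off_support// adde0.
have [f inj surj] := rl_bij rl; split.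
- move=> x xj; have xD := atomsD x xj; split; first by case: (f x xD).
  by rewrite LE//; case: xj.
- by move=> x y /set_mem/atomsD xD /set_mem/atomsD yD; apply: inj; exact: mem_set.
- move=> y [By yj]; have [yD|yD] := pselect (D2 y).
    have [x xD xy] := surj y yD; exists x => //; split; first by case: xD.
    by rewrite -LE// xy.
  by case: zj; rewrite -yj [RHS]pm_addE !relabel_mass0// adde0.
Qed.

Lemma U_relabel_target m :
  U B (pm_add (pm_tr r2 m) (pm_tr relabel nu)) =
  U B (pm_add (pm_tr (restriction (measurable_pm_support nu')) m) nu').
Proof.
apply: eq_U_mass => x Bx; rewrite !pm_addE relabel_source; last exact: measurable_point.
have [xD|xD] := pselect (pm_support nu' x).
  by rewrite !restriction_mass.
have xD2 : ~ D2 x by move=> [].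
by rewrite !restriction_mass0// off_support.
Qed.

End relabelling_transport.

(** * Law of the occupation numbers after one step *)

Section block_transition.
Context {R : realType} {X : polishType R}.
Local Open Scope ereal_scope.
Variables (z : R) (z0 : (0 <= z)%R).
Variables (rho : locFinMeasure X) (rho_diffuse : diffuse rho).
Variable B : boundedBorel X.
Implicit Types (nu m : pointMeasure X) (P : probability (pointMeasure X) R).

Definition tr_on nu : transport := restriction (measurable_pm_support nu).

Definition tr_off nu : transport :=
  restriction (measurableC (measurable_pm_support nu)).

Lemma measurable_blocks_of_old nu :
  measurable_fun setT (fun m => U B (pm_add (pm_tr (tr_on nu) m) nu)).
Proof.
apply: (measurableT_comp (measurable_U B)).
by apply: measurable_pm_add; [exact: measurable_pm_tr|exact: measurable_cst].
Qed.

Lemma measurable_blocks_of_new nu :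
  measurable_fun setT (fun m => U B (pm_tr (tr_off nu) m)).
Proof.
by apply: (measurableT_comp (measurable_U B)); exact: measurable_pm_tr.
Qed.

Lemma measurable_fpm_sum : measurable_fun setT
  (fun u : finPointMeasure R * finPointMeasure R => fpm_add u.2 u.1).
Proof. exact: (measurableT_comp measurable_fpm_add (@measurable_swap _ _ _ _)). Qed.

(** A point of the increment that falls on an atom of nu enlarges an old block;
    the other points form new blocks. *)
Definition old_law nu P := law P (measurable_blocks_of_old nu).

Definition new_law nu P := law P (measurable_blocks_of_new nu).

Definition block_law nu P : probability (finPointMeasure R) R :=
  law (old_law nu P \x new_law nu P)%E measurable_fpm_sum.

Definition block_set nu (A : set (finPointMeasure R)) : set (pointMeasure X) :=
  [set m | A (U B (pm_add nu m))].

Lemma measurable_block_set nu A : measurable (block_set nu A).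
Proof.
have madd : measurable_fun setT (pm_add nu).
  by apply: measurable_pm_add; [exact: measurable_cst|exact: measurable_id].
rewrite -[X in measurable X]setTI.
exact: (measurableT_comp (measurable_U B) madd measurableT (fpm_discrete A)).
Qed.

(** Every point is an atom of at most one of the two summands. *)
Lemma U_split nu m m' :
  U B (pm_add nu (pm_add (pm_tr (tr_on nu) m) (pm_tr (tr_off nu) m'))) =
  fpm_add (U B (pm_tr (tr_off nu) m')) (U B (pm_add (pm_tr (tr_on nu) m) nu)).
Proof.
rewrite -U_add.
  congr (U B _); apply: pm_ext => A; rewrite !pm_addE addeA addeC.
  by congr (_ + _); exact: addeC.
move=> x _; have [xD|xD] := pselect (pm_support nu x).
  by left; rewrite restriction_mass0.
by right; rewrite pm_addE restriction_mass0// off_support// adde0.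
Qed.

(** The parts of the increment on and off the atoms of nu are independent, and
    their contributions to the occupation numbers add up. *)
Lemma block_lawE nu P A : is_polya_sum z (lf_add rho nu) P ->
  P (block_set nu A) = block_law nu P A.
Proof.
move=> HP; rewrite (is_polya_sum_split (measurable_pm_support nu) z0 HP); last first.
  exact: measurable_block_set.
rewrite [LHS]/= [LHS]ge0_integral_law; last 2 first.
- apply: measurable_fun_xsection; rewrite -[X in measurable X]setTI.
  by apply: measurable_pm_convolution => //; exact: measurable_block_set.
- by [].
rewrite [RHS]/= [RHS]ge0_integral_law; last 2 first.
- apply: measurable_fun_xsection; rewrite -[X in measurable X]setTI.
  by apply: measurable_fpm_sum => //; exact: fpm_discrete.
- by [].
apply: eq_integral => m _; rewrite /= /distribution /pushforward; congr (P _).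
apply/seteqP; split=> m' /set_mem Am; apply: mem_set; move: Am;
  by rewrite /= /block_set /= U_split.
Qed.

Lemma support_null nu : rho (pm_support nu) = 0.
Proof. exact: (diffuse_countable rho_diffuse (countable_pm_support nu)). Qed.

Lemma support_subnull nu A : measurable A -> A `<=` pm_support nu -> rho A = 0.
Proof.
move=> mA AS; apply/eqP; rewrite eq_le measure_ge0 andbT -(support_null nu).
by apply: le_measure => //; apply: mem_set => //; exact: measurable_pm_support.
Qed.

(** Off the atoms of nu the intensity rho + nu is rho, as rho does not charge
    the countable set of these atoms. *)
Lemma tr_off_intensity nu A : measurable A ->
  lf_tr (tr_off nu) (lf_add rho nu) A = rho A.
Proof.
move=> mA; have mS := measurable_pm_support nu.
rewrite lf_trE lf_addE [RHS](measureDI rho mA mS); congr (_ + _).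
transitivity (0 : \bar R); last first.
  by apply/esym/(@support_subnull nu); [exact: measurableI|move=> x []].
apply: pm_supportC; first by apply: measurableI => //; exact: measurableC.
by rewrite -setIA setICl setI0.
Qed.

Lemma tr_on_intensity nu A : measurable A ->
  lf_tr (tr_on nu) (lf_add rho nu) A = nu A.
Proof.
move=> mA; rewrite lf_trE lf_addE /tr_preimage /=.
have mS := measurable_pm_support nu.
rewrite [X in X + _](_ : rho _ = 0) ?add0e; last first.
  by apply: (@support_subnull nu); [exact: measurableI|move=> x []].
rewrite [RHS](measureDI nu mA mS) [X in _ = X + _](_ : nu _ = 0) ?add0e//.
apply: pm_supportC; first exact: measurableD.
by rewrite setDE -setIA setICl setI0.
Qed.

Lemma is_polya_sum_ext (kap kap' : locFinMeasure X) P :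
  (forall A, measurable A -> kap A = kap' A) ->
  is_polya_sum z kap P -> is_polya_sum z kap' P.
Proof.
move=> kk' [P1 HP uP]; split; [exact: P1|exact: polya_ext_intensity kk' HP|].
move=> Q HQ A mA; apply: (uP Q _ A mA).
by apply: (@polya_ext_intensity _ _ z kap') HQ => C mC; rewrite kk'.
Qed.

Lemma is_polya_sum_new nu P : is_polya_sum z (lf_add rho nu) P ->
  is_polya_sum z rho (law P (measurable_pm_tr (tr_off nu))).
Proof.
move=> HP; apply: (is_polya_sum_ext (@tr_off_intensity nu)).
exact: is_polya_sum_restriction.
Qed.

Lemma is_polya_sum_old nu P : is_polya_sum z (lf_add rho nu) P ->
  is_polya_sum z nu (law P (measurable_pm_tr (tr_on nu))).
Proof.
move=> HP; apply: (is_polya_sum_ext (@tr_on_intensity nu)).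
exact: is_polya_sum_restriction.
Qed.

Section independence_of_the_representative.
Variables (nu nu' : pointMeasure X) (P P' : probability (pointMeasure X) R).
Hypotheses (HP : is_polya_sum z (lf_add rho nu) P)
  (HP' : is_polya_sum z (lf_add rho nu') P').

(** Both laws of the part off the atoms solve the equation with intensity rho. *)
Lemma new_law_unique A : new_law nu P A = new_law nu' P' A.
Proof.
have [_ _ uP] := is_polya_sum_new HP; have [_ HN' _] := is_polya_sum_new HP'.
have mA : measurable (U B @^-1` A).
  by rewrite -[X in measurable X]setTI; apply: measurable_U => //; exact: fpm_discrete.
exact/esym/(uP _ HN' _ mA).
Qed.

Hypothesis Unn' : U B nu = U B nu'.

(** The relabelling carries the solution for the atoms of nu in B to a
    solution for the atoms of nu' in B, and there is only one. *)
Lemma old_law_unique A : old_law nu P A = old_law nu' P' A.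
Proof.
have [phi rl] := relabelling_exists Unn'.
set t := relabel rl; set r2 := restriction (measurable_pm_support_in B nu').
have [_ _ uP] := is_polya_sum_restriction (measurable_pm_support_in B nu') z0 HP'.
have [_ HPnu _] := HP.
have Ht : polya_sum_equation z (lf_tr r2 (lf_add rho nu')) (law P (measurable_pm_tr t)).
  apply: (@polya_ext_intensity _ _ z (lf_tr t (lf_add rho nu))); last exact: polya_transport.
  move=> C mC; rewrite !lf_tr_add !lf_addE; congr (_ + _); last exact: relabel_source.
  rewrite !lf_trE; transitivity (0 : \bar R); last apply/esym.
    apply: (@support_subnull nu); last by move=> x [_ []].
    exact: (measurable_tr_preimage t).
  apply: (@support_subnull nu'); last by move=> x [_ []].
  exact: (measurable_tr_preimage r2).
pose W := [set m | A (U B (pm_add m (pm_tr t nu)))].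
have mW : measurable W.
  have madd : measurable_fun setT (fun m => pm_add m (pm_tr t nu)).
    by apply: measurable_pm_add; [exact: measurable_id|exact: measurable_cst].
  rewrite -[X in measurable X]setTI.
  exact: (measurableT_comp (measurable_U B) madd measurableT (fpm_discrete A)).
have E : P (pm_tr t @^-1` W) = P' (pm_tr r2 @^-1` W) := uP _ Ht _ mW.
transitivity (P (pm_tr t @^-1` W)).
  by congr (P _); apply/funext => m; exact: (congr1 A (U_relabel rl m)).
rewrite [LHS]E; congr (P' _); apply/funext => m.
exact: (congr1 A (U_relabel_target rl m)).
Qed.

Lemma block_law_unique A : block_law nu P A = block_law nu' P' A.
Proof.
pose S := (fun u : finPointMeasure R * finPointMeasure R => fpm_add u.2 u.1) @^-1` A.
have mS : measurable S.
  rewrite -[X in measurable X]setTI.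
  exact: (measurable_fpm_sum measurableT (fpm_discrete A)).
transitivity (\int[old_law nu P]_x new_law nu' P' (xsection S x)).
  by apply: eq_integral => x _; exact: new_law_unique.
by apply: eq_measure_integral => C _ _; exact: old_law_unique.
Qed.

End independence_of_the_representative.

End block_transition.

(** * The transition formula *)

Section mixture_formula.
Context {R : realType} {X : polishType R}.
Local Open Scope ereal_scope.
Variables (B : boundedBorel X) (nu : pointMeasure X)
  (P : probability (pointMeasure X) R).

(** Convolution with the point mass at nu is translation by nu. *)
Lemma old_lawE A : old_law B nu P A =
  law (law (law P (measurable_pm_tr (tr_on nu)) \x (\d_nu : probability _ R))%E
    (@measurable_pm_convolution R X)) (measurable_U B) A.
Proof.
pose S := (fun m : pointMeasure X * pointMeasure X => pm_add m.1 m.2) @^-1` (U B @^-1` A).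
have mU : measurable (U B @^-1` A).
  by rewrite -[X in measurable X]setTI; exact: (measurable_U B measurableT (fpm_discrete A)).
have mS : measurable S.
  by rewrite -[X in measurable X]setTI; exact: (@measurable_pm_convolution R X measurableT _ mU).
rewrite -[RHS]/(\int[law P (measurable_pm_tr (tr_on nu))]_m \d_nu (xsection S m)).
rewrite ge0_integral_law; last 2 first.
- exact: measurable_fun_xsection.
- by [].
rewrite -[LHS]/(P ((fun m => U B (pm_add (pm_tr (tr_on nu) m) nu)) @^-1` A)).
have mA : measurable ((fun m => U B (pm_add (pm_tr (tr_on nu) m) nu)) @^-1` A).
  by rewrite -[X in measurable X]setTI; exact: (measurable_blocks_of_old B nu measurableT (fpm_discrete A)).
rewrite -[in LHS](setIT (_ @^-1` A)) -(integral_indic P measurableT mA).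
apply: eq_integral => m _; rewrite diracE indicE; congr (nat_of_bool _)%:R%:E.
by apply/idP/idP => /set_mem h; apply: mem_set; [exact: mem_set h|exact: set_mem h].
Qed.

Lemma integral_block_law (f : finPointMeasure R -> R) :
  measurable_fun setT f -> (exists M : R, forall x, (`|f x| <= M)%R) ->
  \int[block_law B nu P]_x (f x)%:E =
  \int[pushforward (pm_convolution (law P (measurable_pm_tr (tr_on nu))) \d_nu) (U B)]_eta_b
    \int[pushforward (law P (measurable_pm_tr (tr_off nu))) (U B)]_eta_i
      (f (fpm_add eta_i eta_b))%:E.
Proof.
move=> mf [M fM].
pose g (u : finPointMeasure R * finPointMeasure R) := f (fpm_add u.2 u.1).
have mg : measurable_fun setT g by exact: (measurableT_comp mf (@measurable_fpm_sum R)).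
have ig : (old_law B nu P \x new_law B nu P)%E.-integrable setT (EFin \o g).
  apply: measurable_bounded_integrable => //.
    by rewrite [X in X < _](probability_setT (old_law B nu P \x new_law B nu P)%E) ltry.
  by exists M; split; rewrite ?num_real // => x Mx u _; exact: le_trans (fM _) (ltW Mx).
rewrite integral_distribution; [|exact/measurable_EFinP|exact: ig].
rewrite -(integral12_prod_meas1 ig).
apply: (@eq_measure_integral _ _ _ setT (law (law (law P (measurable_pm_tr (tr_on nu)) \x (\d_nu : probability _ R))%E
    (@measurable_pm_convolution R X)) (measurable_U B))) => A _ _.
exact: old_lawE.
Qed.

End mixture_formula.

(** * Increments and their joint law with the present *)

Section difference.
Context {R : realType} {X : polishType R}.
Local Open Scope ereal_scope.

Section finite_difference.
Context d (T : measurableType d).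
Variables mu nu : {measure set T -> \bar R}.
Hypothesis finnu : forall A, measurable A -> nu A \is a fin_num.
Hypothesis munu : forall A, measurable A -> mu A <= nu A.

Let finmu A : measurable A -> mu A \is a fin_num.
Proof.
move=> mA; rewrite ge0_fin_numE//; apply: (le_lt_trans (munu mA)).
by rewrite -ge0_fin_numE ?finnu.
Qed.

(** The hypothesis on mu and nu only concerns measurable sets, but a measure has
    to be nonnegative on all sets; hence the value 0 off the measurable ones. *)
Definition mdiff (A : set T) := if A \in measurable then nu A - mu A else 0.

Lemma mdiffE A : measurable A -> mdiff A = nu A - mu A.
Proof. by move=> mA; rewrite /mdiff mem_set. Qed.

Let mdiff0 : mdiff set0 = 0.
Proof. by rewrite mdiffE// !measure0 sube0. Qed.

Let mdiff_ge0 A : 0 <= mdiff A.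
Proof.
rewrite /mdiff; case: ifPn => // /set_mem mA.
by rewrite sube_ge0 ?munu// finmu.
Qed.

Let mdiff_sigma_additive : semi_sigma_additive mdiff.
Proof.
move=> F mF tF mUF; rewrite mdiffE//.
rewrite (_ : (fun n => _) = (fun n => \sum_(0 <= i < n) nu (F i) - \sum_(0 <= i < n) mu (F i))).
  apply: cvgeB; first by rewrite fin_num_adde_defr// finnu.
  - exact: measure_semi_sigma_additive.
  - exact: measure_semi_sigma_additive.
apply/funext => n; rewrite -fin_num_sumeN => [|i _]; last exact: finmu.
by rewrite -big_split /=; apply: eq_bigr => i _; rewrite mdiffE.
Qed.

HB.instance Definition _ :=
  isMeasure.Build _ _ _ mdiff mdiff0 mdiff_ge0 mdiff_sigma_additive.

Definition finite_difference : {measure set T -> \bar R} := mdiff.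

End finite_difference.

Section pm_difference.
Variables mu nu : pointMeasure X.
Hypothesis munu : forall A, measurable A -> mu A <= nu A.

Let restr_fin n (A : set (borel X)) : measurable A ->
  mrestr nu (@measurable_annulus R X n) A \is a fin_num.
Proof. by move=> mA; exact: (pm_fin_num nu (bb_restr mA (bb_annulus X n))). Qed.

Let restr_le n (A : set (borel X)) : measurable A ->
  mrestr mu (@measurable_annulus R X n) A <= mrestr nu (@measurable_annulus R X n) A.
Proof.
by move=> mA; apply: munu; apply: measurableI => //; exact: measurable_annulus.
Qed.

Let xi : {measure set (borel X) -> \bar R} :=
  mseries (fun n => finite_difference (@restr_fin n) (@restr_le n)) 0.

Let xiE A : measurable A -> nu A = mu A + xi A.
Proof.
move=> mA; rewrite (measure_annulus nu mA) (measure_annulus mu mA).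
rewrite -nneseriesD; [|by move=> *; exact: measure_ge0..].
apply: eq_eseriesr => n _; rewrite /= mdiffE// /mrestr addeC subeK//.
exact: (pm_fin_num mu (bb_restr mA (bb_annulus X n))).
Qed.

Lemma pm_difference_exists : exists xi : pointMeasure X,
  forall A, measurable A -> nu A = mu A + xi A.
Proof.
have xiB (B : boundedBorel X) : exists n : nat, xi B = n%:R%:E.
  have mB := bb_measurable B; have := xiE mB; have := munu mB.
  have [a ->] := pm_integer mu B; have [b ->] := pm_integer nu B.
  rewrite lee_fin ler_nat => ab E; exists (b - a)%N; rewrite natrB// EFinB E.
  by rewrite addeAC subee// add0e.
have xi_fin (B : boundedBorel X) : xi B < +oo by have [n ->] := xiB B; exact: ltry.
by exists (@PointMeasure _ _ (LocFinMeasure xi_fin) xiB).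
Qed.

Lemma pm_subE A : measurable A -> nu A = mu A + pm_sub nu mu A.
Proof.
move=> mA; rewrite /pm_sub; case: xgetP => [y _ Hy|H]; first exact: Hy.
by have [y Hy] := pm_difference_exists; have := H y Hy.
Qed.

End pm_difference.

End difference.

Section joint_law.
Context {R : realType} {d d1 d2 : measure_display} {Omega : measurableType d}
  {T1 : measurableType d1} {T2 : measurableType d2}.
Local Open Scope ereal_scope.
Variables (P : probability Omega R) (V : Omega -> T2) (W : Omega -> T1)
  (K : R.-pker T1 ~> T2).
Hypotheses (mV : measurable_fun setT V) (mW : measurable_fun setT W).
Hypothesis HK : conditional_law P V W K.

Let k (E : set (T1 * T2)) w := K (W w) (xsection E (W w)).

Let mk E : measurable E -> measurable_fun setT (k E).
Proof.
move=> mE; apply: (measurableT_comp (f := fun x => K x (xsection E x)) _ mW).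
by apply: measurable_fun_xsection_finite_kernel; exact: mem_set.
Qed.

Let k0 E w : 0 <= k E w. Proof. exact: measure_ge0. Qed.

Let k1 E w : measurable E -> k E w <= 1.
Proof.
move=> mE; rewrite -(@prob_kernel _ _ _ _ _ K (W w)); apply: le_measure => //; apply: mem_set => //.
exact: measurable_xsection.
Qed.

(** Both sides are additive in E and agree on rectangles by definition. *)
Lemma conditional_law_joint (E : set (T1 * T2)) : measurable E ->
  P [set w | E (W w, V w)] = \int[P]_w K (W w) (xsection E (W w)).
Proof.
have mpair : measurable_fun setT (fun w => (W w, V w)) by exact: measurable_fun_pair.
have mpre (C : set (T1 * T2)) : measurable C -> measurable [set w | C (W w, V w)].
  by move=> mC; rewrite -[X in measurable X]setTI; exact: mpair.
move=> mE; have := mE; rewrite measurable_prod_measurableType.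
apply: (dynkin_induction (G := [set A `*` B | A in measurable & B in measurable])
  (P := fun E => P [set w | E (W w, V w)] = \int[P]_w k E w)).
- exact: measurable_prod_measurableType.
- move=> _ _ [A1 mA1 [B1 mB1 <-]] [A2 mA2 [B2 mB2 <-]].
  exists (A1 `&` A2); first exact: measurableI.
  by exists (B1 `&` B2); [exact: measurableI|rewrite setXI].
- rewrite (_ : [set _ | _] = setT); last by apply/seteqP; split.
  rewrite probability_setT (eq_integral (cst 1)) => [|w _].
    by rewrite integral_cst// mul1e; exact/esym/probability_setT.
  rewrite /k (_ : xsection _ _ = setT) ?prob_kernel//.
  by apply/seteqP; split=> // y _; exact: mem_set.
- move=> _ [A mA [C mC <-]].
  have -> : [set w | (A `*` C) (W w, V w)] = W @^-1` A `&` V @^-1` C by [].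
  rewrite HK// integral_mkcond; apply: eq_integral => w _; rewrite patchE /k.
  case: ifPn => wA; first by rewrite in_xsectionX.
  by rewrite notin_xsectionX// measure0.
- move=> S mS IH.
  have -> : [set w | (~` S) (W w, V w)] = ~` [set w | S (W w, V w)] by [].
  rewrite probability_setC; last exact: mpre.
  rewrite IH; transitivity (\int[P]_w (1 - k S w)).
    have ik : P.-integrable setT (k S).
      apply: (@le_integrable _ _ _ P setT measurableT _ (cst 1)) => //.
      - exact: mk.
      - by move=> w _; rewrite gee0_abs// gee0_abs ?k1.
      - exact: finite_measure_integrable_cst.
    rewrite integralB//; last exact: finite_measure_integrable_cst.
    by rewrite integral_cst// mul1e; congr (_ - _); exact/esym/probability_setT.
  apply: eq_integral => w _; rewrite /k (_ : xsection (~` S) _ = ~` xsection S (W w)).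
    exact/esym/(probability_setC (prob_of (@prob_kernel _ _ _ _ _ K (W w))) (measurable_xsection _ mS)).
  by apply/seteqP; split=> y; rewrite /xsection /=;
    [move=> /set_mem /= nS /set_mem|move=> nS; apply: mem_set => /= /mem_set].
- move=> F mF tF IH.
  have -> : [set w | (\bigcup_n F n) (W w, V w)] = \bigcup_n [set w | F n (W w, V w)].
    by apply/seteqP; split=> w [n _ Fn]; exists n.
  rewrite measure_bigcupT; last 2 first.
  - by move=> n; exact: mpre.
  - apply/trivIsetP => i j _ _ ij; apply/seteqP; split=> // w [/= Fi Fj].
    by move/trivIsetP : tF => /(_ i j Logic.I Logic.I ij); rewrite -subset0; apply; split; [exact: Fi|exact: Fj].
  rewrite (eq_integral (fun w => \sum_(n <oo) k (F n) w)) => [|w _].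
    rewrite integral_nneseries//; last by move=> n; exact: mk.
    by apply: eq_eseriesr => n _; exact: IH.
  rewrite /k xsection_bigcup measure_bigcupT//.
  - by move=> n; exact: measurable_xsection.
  - exact: trivIset_xsection.
Qed.

End joint_law.

(** * Discrete kernels and pasts *)

Section discrete_kernel.
Context {R : realType} (sel : finPointMeasure R -> probability (finPointMeasure R) R).

Definition discrete_kernel (eta : finPointMeasure R) :
  {measure set (finPointMeasure R) -> \bar R} := sel eta.

Let measurable_discrete_kernel A : measurable A ->
  measurable_fun setT (discrete_kernel ^~ A).
Proof. by move=> _ _ C _; exact: fpm_discrete. Qed.

HB.instance Definition _ :=
  isKernel.Build _ _ _ _ _ discrete_kernel measurable_discrete_kernel.

Let discrete_kernelT eta : discrete_kernel eta setT = 1%E.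
Proof. exact: probability_setT. Qed.

HB.instance Definition _ :=
  Kernel_isProbability.Build _ _ _ _ _ discrete_kernel discrete_kernelT.

End discrete_kernel.

Section past.
Context {R : realType} {d d' d'' : measure_display} {Omega : measurableType d}
  {T : measurableType d'} {T' : measurableType d''}.
Variables (Z : R -> Omega -> T) (f : T -> T').

Lemma past_comp (s : R) : measurable_fun setT f ->
  past (fun r w => f (Z r w)) s `<=` past Z s.
Proof.
move=> mf; apply: sub_sigma_algebra2 => _ [r rs [A mA <-]].
exists r => //; exists (f @^-1` A) => //.
by rewrite -[X in measurable X]setTI; exact: mf.
Qed.

Lemma past_measurable (s : R) : is_process Z -> (s < 1)%R ->
  past Z s `<=` measurable.
Proof.
move=> mZ s1; apply: smallest_sub.
  by split=> [|A mA|F mF]; [exact: measurable0|rewrite setTD; exact: measurableC|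
    exact: bigcupT_measurable].
move=> _ [r + [A mA <-]]; rewrite /= in_itv /= => /andP[r0 rs].
rewrite -[X in measurable X]setTI; apply: mZ => //.
by rewrite r0 (le_lt_trans rs s1).
Qed.

Lemma past_present (s : R) C : (0 <= s)%R -> measurable C -> past Z s (Z s @^-1` C).
Proof.
move=> s0 mC; apply: sub_sigma_algebra; exists s; last by exists C.
by rewrite /= in_itv /= s0 lexx.
Qed.

End past.

Section markov_uniqueness.
Context {R : realType} {d d' : measure_display} {Omega : measurableType d}
  {T : measurableType d'}.
Local Open Scope ereal_scope.
Variables (P : probability Omega R) (W : Omega -> T).
Hypothesis mW : measurable_fun setT W.

(** A conditional expectation given W is determined almost surely by its
    integrals over events of the form W in C. *)
Lemma eq_integral_given (g q : T -> \bar R) :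
  measurable_fun setT g -> measurable_fun setT q ->
  (forall x, 0 <= g x) -> (forall x, 0 <= q x) -> (forall x, q x <= 1) ->
  (forall C, measurable C ->
    \int[P]_(w in W @^-1` C) g (W w) = \int[P]_(w in W @^-1` C) q (W w)) ->
  forall G, measurable G -> \int[P]_(w in G) g (W w) = \int[P]_(w in G) q (W w).
Proof.
move=> mg mq g0 q0 q1 H G mG.
pose L := law P mW.
have iq : L.-integrable setT q.
  apply: (@le_integrable _ _ _ L setT measurableT _ (cst 1)) => //.
  - by move=> x _; rewrite gee0_abs// gee0_abs.
  - exact: finite_measure_integrable_cst.
have HL f C : measurable C -> measurable_fun setT f -> (forall x, 0 <= f x) ->
    \int[L]_(x in C) f x = \int[P]_(w in W @^-1` C) f (W w).
  move=> mC mf f0; rewrite ge0_integral_pushforward//.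
  exact: measurable_funS mf.
have [N [mN N0 qgN]] : ae_eq L setT q g.
  apply: integral_ae_eq => // E _ mE.
  by rewrite !HL// H.
apply: ge0_ae_eq_integral => //.
- by apply: measurable_funTS; exact: measurableT_comp.
- by apply: measurable_funTS; exact: measurableT_comp.
exists (W @^-1` N); split.
- by rewrite -[X in measurable X]setTI; exact: mW.
- exact: N0.
- move=> w nw; apply: qgN => qg; apply: nw => _.
  by rewrite -qg.
Qed.

End markov_uniqueness.

(** * The Markov property of the occupation numbers *)

Section block_kernel.
Context {R : realType} {X : polishType R}.
Local Open Scope ereal_scope.
Variables (z : R) (z0 : (0 <= z)%R).
Variables (rho : locFinMeasure X) (rho_diffuse : diffuse rho).
Variable (B : boundedBorel X).
Variable (K : R.-pker (pointMeasure X) ~> (pointMeasure X)).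
Implicit Type nu : pointMeasure X.

Definition regular nu := is_polya_sum z (lf_add rho nu) (K nu).

Definition kernel_prob nu : probability (pointMeasure X) R :=
  prob_of (@prob_kernel _ _ _ _ _ K nu).

Lemma regularP nu : regular nu -> is_polya_sum z (lf_add rho nu) (kernel_prob nu).
Proof. by []. Qed.

(** By block_law_unique every regular nu with occupation numbers eta gives the
    same law; the Dirac mass fills in the eta that no regular nu has. *)
Definition block_choice (eta : finPointMeasure R) :
    probability (finPointMeasure R) R :=
  if pselect (exists nu, regular nu /\ U B nu = eta) is left e
  then block_law B (projT1 (cid e)) (kernel_prob (projT1 (cid e)))
  else \d_eta.

Definition block_kernel : R.-pker (finPointMeasure R) ~> (finPointMeasure R) :=
  discrete_kernel block_choice.

Lemma block_kernelE nu A : regular nu ->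
  block_kernel (U B nu) A = block_law B nu (kernel_prob nu) A.
Proof.
move=> rnu; rewrite /block_kernel /= /discrete_kernel /block_choice.
case: pselect => [e|H]; last by exfalso; apply: H; exists nu.
case: (cid e) => nu' [rnu' E] /=.
exact: (block_law_unique z0 rho_diffuse (regularP rnu') (regularP rnu) E).
Qed.

Lemma block_kernel_block_set nu A : regular nu ->
  K nu (block_set B nu A) = block_kernel (U B nu) A.
Proof.
move=> rnu; rewrite block_kernelE//.
exact: (@block_lawE _ _ z z0 rho B nu (kernel_prob nu) A (regularP rnu)).
Qed.

Context {d : measure_display} {Omega : measurableType d} (P : probability Omega R).
Variables (W Y V : Omega -> pointMeasure X).
Hypotheses (mW : measurable_fun setT W) (mV : measurable_fun setT V).
Hypothesis YE : forall w A, measurable A -> Y w A = W w A + V w A.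
Hypothesis HK : conditional_law P V W K.
Hypothesis Kreg : {ae pushforward P W, forall nu, regular nu}.

(** The event depends on Y only through the pair of W and V, and for almost every
    value nu of W the kernel at nu charges block_set nu A as block_kernel does. *)
Lemma integral_block_kernel A C : measurable C ->
  P (W @^-1` C `&` (U B \o Y) @^-1` A) =
  \int[P]_(w in W @^-1` C) block_kernel (U B (W w)) A.
Proof.
move=> mC.
pose E := [set u : pointMeasure X * pointMeasure X |
  C u.1 /\ A (U B (pm_add u.1 u.2))].
have mE : measurable E.
  have -> : E = fst @^-1` C `&`
      (fun u : pointMeasure X * pointMeasure X => U B (pm_add u.1 u.2)) @^-1` A by [].
  apply: measurableI; rewrite -[X in measurable X]setTI.
    exact: (@measurable_fst _ _ (pointMeasure X) (pointMeasure X) measurableT C mC).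
  exact: (measurableT_comp (measurable_U B) (@measurable_pm_convolution R X)
    measurableT (fpm_discrete A)).
have -> : W @^-1` C `&` (U B \o Y) @^-1` A = [set w | E (W w, V w)].
  have UE w : U B (Y w) = U B (pm_add (W w) (V w)).
    by apply: eq_U_mass => x _; rewrite pm_addE; apply: YE; exact: measurable_point.
  by apply/funext => w; rewrite /E /= /setI /preimage /= UE.
rewrite (conditional_law_joint mV mW HK mE) [RHS]integral_mkcond.
have mk : measurable_fun setT (fun nu => K nu (xsection E nu)).
  by apply: measurable_fun_xsection_finite_kernel; exact: mem_set.
have mq : measurable_fun setT ((fun nu => block_kernel (U B nu) A) \_ C).
  apply/(measurable_restrictT _ mC); apply: measurable_funTS.
  exact: (measurableT_comp (measurable_kernel block_kernel A (fpm_discrete A)) (measurable_U B)).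
have mWC : measurable (W @^-1` C).
  by rewrite -[X in measurable X]setTI; exact: mW.
have patch0 (nu : pointMeasure X) : 0 <= ((fun nu => block_kernel (U B nu) A) \_ C) nu.
  by rewrite patchE; case: ifPn.
rewrite (_ : _ \_ _ = ((fun nu => block_kernel (U B nu) A) \_ C) \o W); last first.
  by apply/funext => w; rewrite /= !patchE.
apply: ge0_ae_eq_integral.
- exact: measurableT.
- exact: (measurableT_comp mk mW).
- exact: (measurableT_comp mq mW).
- by [].
- by move=> w _; exact: patch0.
have [N [mN N0 regN]] := Kreg.
exists (W @^-1` N); split.
- by rewrite -[X in measurable X]setTI; exact: mW.
- exact: N0.
- move=> w nw; apply: regN => rW; apply: nw => _ /=.
  rewrite patchE; case: ifPn => [/set_mem WC|/negP WC].
    rewrite -block_kernel_block_set//; congr (K _ _).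
    by apply/seteqP; split=> m; rewrite /xsection /=;
      [move=> /set_mem []|move=> Am; apply: mem_set].
  rewrite (_ : xsection E (W w) = set0) ?measure0//.
  apply/seteqP; split=> // m; rewrite /xsection /= => /set_mem [/= WCw _].
  by apply: WC; exact: mem_set.
Qed.

End block_kernel.

Section increments.
Context {R : realType} {X : polishType R} {d : measure_display}
  {Omega : measurableType d} (P : probability Omega R)
  (rho : locFinMeasure X) (rho_diffuse : diffuse rho) (Y : R -> Omega -> pointMeasure X).
Hypothesis crY : chinese_restaurant P rho Y.
Variables (s t : R).
Hypotheses (s0 : 0 <= s) (st : s < t) (t1 : t < 1).
Local Open Scope ereal_scope.

Lemma cr_measurable (r : R) : (0 <= r < 1)%R -> measurable_fun setT (Y r).
Proof. by case: (cr_markov crY) => mY _; exact: mY. Qed.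

Let ms : measurable_fun setT (Y s).
Proof. by apply: cr_measurable; rewrite s0 (lt_trans st). Qed.

Let mt : measurable_fun setT (Y t).
Proof. by apply: cr_measurable; rewrite t1 (ltW (le_lt_trans s0 st)). Qed.

Lemma cr_incrementE w A : measurable A ->
  Y t w A = Y s w A + pm_sub (Y t w) (Y s w) A.
Proof.
move=> mA; apply: pm_subE => // C mC.
by apply: (cr_increasing crY) => //; exact: ltW.
Qed.

Lemma measurable_increment : measurable_fun setT (fun w => pm_sub (Y t w) (Y s w)).
Proof.
apply: measurable_fun_pm => B.
rewrite (_ : (fun w => _) = (fun w => Y t w B) \- (fun w => Y s w B)).
  apply: emeasurable_funB.
    exact: (measurableT_comp (measurable_eval_bb B) mt).
  exact: (measurableT_comp (measurable_eval_bb B) ms).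
apply/funext => w; rewrite /= (cr_incrementE w (bb_measurable B)).
by rewrite addeAC subee ?add0e// pm_fin_num.
Qed.

(** The Markov property of Y provides a conditional probability g (Y s) given the
    past; integral_block_kernel computes it over the events that Y s lies in C,
    which determines it almost surely. *)
Lemma block_transition (B : boundedBorel X) :
  exists p : R.-pker (finPointMeasure R) ~> (finPointMeasure R),
    transition_kernel P (fun r w => U B (Y r w)) s t p /\
    forall eta : finPointMeasure R,
      {ae pushforward P (Y s), forall nu : pointMeasure X, U B nu = eta ->
      exists Si Sb : probability (pointMeasure X) R,
        [/\ is_polya_sum ((t - s) / (1 - s)) rho Si,
            is_polya_sum ((t - s) / (1 - s)) nu Sb &
            forall f : finPointMeasure R -> R, measurable_fun setT f ->
              (exists M : R, forall x, (`|f x| <= M)%R) ->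
              \int[p eta]_x (f x)%:E =
               \int[pushforward (pm_convolution Sb \d_nu) (U B)]_eta_b
                 \int[pushforward Si (U B)]_eta_i
                   (f (fpm_add eta_i eta_b))%:E]}.
Proof.
have [K [HK Kreg]] := cr_increment crY s0 st t1.
set z := ((t - s) / (1 - s))%R in Kreg *.
have z0 : (0 <= z)%R.
  by rewrite divr_ge0// subr_ge0 ltW// (lt_trans st).
exists (block_kernel z rho B K); split.
  move=> A G mA pG; rewrite -[X in P X]/(G `&` Y t @^-1` (U B @^-1` A)).
  have mUA : measurable (U B @^-1` A).
    by rewrite -[X in measurable X]setTI; exact: (measurable_U B measurableT mA).
  have pastG := past_comp (measurable_U B) pG.
  have [mY HY] := cr_markov crY.
  have [g [mg g0 Hg]] := HY s t s0 st t1 _ mUA.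
  rewrite (Hg _ pastG).
  apply: (@eq_integral_given _ _ _ _ _ P (Y s) ms g
    (fun nu => block_kernel z rho B K (U B nu) A)) => //.
  - exact: (measurableT_comp (measurable_kernel (block_kernel z rho B K) A mA)
      (measurable_U B)).
  - move=> nu; rewrite -(@prob_kernel _ _ _ _ _ (block_kernel z rho B K) (U B nu)).
    by apply: le_measure => //; apply: mem_set.
  - move=> C mC; rewrite -(Hg _ (past_present s0 mC)).
    exact: (integral_block_kernel z0 rho_diffuse B ms measurable_increment
      cr_incrementE HK Kreg A mC).
  - by apply: (past_measurable mY (lt_trans st t1)).
move=> eta; apply: negligibleS Kreg; first exact: ms.
apply: subsetC => nu rnu Unu.
exists (law (kernel_prob K nu) (measurable_pm_tr (tr_off nu))).
exists (law (kernel_prob K nu) (measurable_pm_tr (tr_on nu))); split.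
- exact: (is_polya_sum_new z0 rho_diffuse (regularP rnu)).
- exact: (is_polya_sum_old z0 rho_diffuse (regularP rnu)).
- move=> f mf bf; rewrite -integral_block_law// -Unu.
  apply: eq_measure_integral => A mA _.
  exact: (block_kernelE z0 rho_diffuse B A rnu).
Qed.

End increments.

Theorem lemma4p2 (R : realType) (X : polishType R) (d : measure_display)
    (Omega : measurableType d) (P : probability Omega R)
    (rho : locFinMeasure X) (rho_diffuse : diffuse rho)
    (Y : R -> Omega -> pointMeasure X) (crY : chinese_restaurant P rho Y)
    (B : boundedBorel X) :
  let UB := fun t w => U B (Y t w) in
  markov_process P UB /\
  forall s t : R, 0 <= s -> s < t -> t < 1 ->
  exists p : R.-pker (finPointMeasure R) ~> (finPointMeasure R),
    transition_kernel P UB s t p /\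
    forall eta : finPointMeasure R,
      {ae pushforward P (Y s), forall nu : pointMeasure X, U B nu = eta ->
      exists Si Sb : probability (pointMeasure X) R,
        [/\ is_polya_sum ((t - s) / (1 - s)) rho Si,
            is_polya_sum ((t - s) / (1 - s)) nu Sb &
            forall f : finPointMeasure R -> R, measurable_fun setT f ->
              (exists M : R, forall x, `|f x| <= M) ->
              (\int[p eta]_x (f x)%:E =
               \int[pushforward (pm_convolution Sb \d_nu) (U B)]_eta_b
                 \int[pushforward Si (U B)]_eta_i
                   (f (fpm_add eta_i eta_b))%:E)%E]}.
Proof.
move=> UB; have [mY _] := cr_markov crY.
have mUB : is_process UB.
  by move=> r r01; apply: (measurableT_comp (measurable_U B)); exact: mY.
split; last first.
  by move=> s t s0 st t1; exact: (block_transition rho_diffuse crY s0 st t1 B).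
split=> // s t s0 st t1 A mA.
have [p [Hp _]] := block_transition rho_diffuse crY s0 st t1 B.
exists (fun eta => p eta A); split.
- exact: measurable_kernel.
- by move=> eta; exact: measure_ge0.
- by move=> G pG; exact: Hp.
Qed.
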